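(* Let $\mathbf{F}_2$ denote the free group on two generators. The group $\mathbf{F}_2\times\mathbf{F}_2\times\mathbf{Z}/2\mathbf{Z}$ has a Cayley graph which is not LG-rigid, and the group $\mathrm{SL}_4(\mathbf{Z})$ has a Cayley graph which is not LG-rigid.
   Context: A ''graph'' means a connected, locally finite graph without loops or multiple edges, equipped with the geodesic metric giving each edge length $1$; ''$x\in X$'' means that $x$ is a vertex of $X$; balls are closed balls. A covering from a graph $X$ to a graph $Y$ is a graph covering map (a surjective graph morphism which, for every vertex $x$, maps the neighbors of $x$ bijectively onto the neighbors of its image); $Y$ is covered by $X$ if such a map $X\to Y$ exists. Given a finitely generated group $G$ and a finite symmetric generating set $S$, the Cayley graph $(G,S)$ is the graph with vertex set $G$ and distance $d(g,h)=|g^{-1}h|_S$ (word length). A Cayley graph of $G$ is $(G,S)$ for some finite symmetric generating set $S$. Given a graph $X$ and $R>0$, a graph $Y$ is $R$-locally $X$ if for every vertex $y\in Y$ there exists $x\in X$ such that the balls $B_X(x,R)$ and $B_Y(y,R)$, equipped with their intrinsic geodesic metrics, are isometric. $X$ is LG-rigid at scale $R$ if every graph which is $R$-locally $X$ is covered by $X$. $X$ is LG-rigid if it is LG-rigid at scale $R$ for some $R>0$. *)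

(* Defs.v *)
From Stdlib Require Import Relations.Relation_Operators.
From HB Require Import structures.
From mathcomp Require Import all_boot all_order all_algebra all_fingroup.
From mathcomp Require Import boolp classical_sets functions cardinality.
From mathcomp Require Import reals constructive_ereal ereal numfun.

Set Implicit Arguments.
Unset Strict Implicit.
Unset Printing Implicit Defensive.

Import Order.TTheory GRing.Theory Num.Theory.

Local Open Scope classical_set_scope.
Local Open Scope ring_scope.

(* [graph_vertex] excludes the empty graph: it is [R]-locally [X] for every
   [X], but it is not covered by any nonempty graph. *)
Record graph := Graph {
  vertex :> Type;
  adj : vertex -> vertex -> Prop;
  adj_sym : forall x y, adj x y -> adj y x;
  adj_irrefl : forall x, ~ adj x x;
  adj_locally_finite : forall x, finite_set [set y | adj x y];
  graph_connected : forall x y, clos_refl_trans vertex adj x y;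
  graph_vertex : inhabited vertex
}.
Arguments adj {g}.

Definition is_covering (X Y : graph) (f : X -> Y) : Prop :=
  [/\ set_surj [set: X] [set: Y] f,
      forall x x', adj x x' -> adj (f x) (f x')
    & forall x, set_bij [set x' | adj x x'] [set y | adj (f x) y] f].

Definition covered_by (Y X : graph) : Prop :=
  exists f : X -> Y, is_covering f.

Section MetricGraph.
Variables (K : realType) (X : graph).

(* Points of the metric graph are given by their barycentric coordinates,
   so that they are functions [X -> K]. *)
Definition vertex_pt (u : X) : X -> K := \1_[set u].

Definition edge_pt (u v : X) (t : K) : X -> K :=
  fun w => (1 - t) * vertex_pt u w + t * vertex_pt v w.

Definition realization : set (X -> K) :=
  [set p | (exists u, p = vertex_pt u) \/
           (exists u v t, [/\ adj u v, 0 <= t <= 1 & p = edge_pt u v t])].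

(* [pl_path A p q l]: there is a path of length [l] from [p] to [q] that stays
   in [A] and is a concatenation of segments of edges. *)
Inductive pl_path (A : set (X -> K)) : (X -> K) -> (X -> K) -> K -> Prop :=
| pl_nil p : A p -> pl_path A p p 0
| pl_cons u v s t q l :
    adj u v -> 0 <= s <= 1 -> 0 <= t <= 1 ->
    (forall r, Num.min s t <= r <= Num.max s t -> A (edge_pt u v r)) ->
    pl_path A (edge_pt u v t) q l ->
    pl_path A (edge_pt u v s) q (`|s - t| + l).

(* The intrinsic geodesic metric of a part [A] of the metric graph; for
   [A = realization] it is the geodesic metric of the graph. *)
Definition intrinsic_dist (A : set (X -> K)) (p q : X -> K) : \bar K :=
  ereal_inf [set l%:E | l in [set l | pl_path A p q l]].

(* The closed ball of the metric graph: it contains edges and parts of edges,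
   not only vertices. *)
Definition gball (x : X) (R : K) : set (X -> K) :=
  [set p | realization p /\
           (intrinsic_dist realization (vertex_pt x) p <= R%:E)%E].

End MetricGraph.

Definition isometric (K : realType) (X Y : graph)
    (A : set (X -> K)) (B : set (Y -> K)) : Prop :=
  exists f : (X -> K) -> (Y -> K),
    set_bij A B f /\
    forall p q, A p -> A q ->
      intrinsic_dist B (f p) (f q) = intrinsic_dist A p q.

Definition R_locally (K : realType) (R : K) (X Y : graph) : Prop :=
  forall y : Y, exists x : X, isometric (gball x R) (gball y R).

Definition LG_rigid_at (K : realType) (R : K) (X : graph) : Prop :=
  forall Y : graph, R_locally R X Y -> covered_by Y X.

Definition LG_rigid (K : realType) (X : graph) : Prop :=
  exists R : K, 0 < R /\ LG_rigid_at R X.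

(* Since [S] is symmetric, generation as a group and as a monoid agree. *)
Definition product_of_length (G : groupType) (S : set G) (n : nat) : set G :=
  [set g | exists w : seq G,
     [/\ size w = n, forall s, s \in w -> S s & g = (\prod_(s <- w) s)%g]].

Record gen_set (G : groupType) := GenSet {
  gens : set G;
  gens_finite : finite_set gens;
  gens_sym : forall s, gens s -> gens s^-1%g;
  gens_gen : forall g, exists n, product_of_length gens n g
}.

Section Cayley.
Variables (G : groupType) (S : gen_set G).

Fact word_length_subproof (g : G) : exists n, `[<product_of_length (gens S) n g>].
Proof. by have [n Hn] := gens_gen S g; exists n; apply/asboolP. Qed.

Definition word_length (g : G) : nat := ex_minn (word_length_subproof g).

(* The graph on [G] with distance [word_length (g^-1 * h)]: as edges have
   length 1, its edges are the pairs at distance 1. *)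
Definition cayley_adj (g h : G) : Prop := word_length (g^-1 * h)%g = 1%N.

Lemma cayley_adjP (g h : G) : cayley_adj g h <-> gens S (g^-1 * h)%g /\ g <> h.
Proof.
rewrite /cayley_adj /word_length; case: ex_minnP => n /asboolP[w [sw Sw gw]] mn.
have n0 : (n == 0%N) = (g == h).
  apply/eqP/eqP => [n0|gh].
    move: sw gw; rewrite n0 => /size0nil ->; rewrite big_nil => /(congr1 (mulg g)).
    by rewrite mulKVg mulg1 => ->.
  apply/eqP; rewrite -leqn0; apply: mn; apply/asboolP; exists [::].
  by split=> //; rewrite gh mulVg big_nil.
split=> [n1|[Sg /eqP gh]].
  split; last by move/eqP; rewrite -n0 n1.
  move: sw Sw gw; rewrite n1; case: w => [//|s [|//]] _ Sw ->.
  by rewrite big_seq1; apply: Sw; rewrite inE.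
apply/eqP; rewrite eqn_leq lt0n n0 gh andbT; apply: mn; apply/asboolP.
by exists [:: (g^-1 * h)%g]; split=> [//|s|]; rewrite ?inE ?big_seq1 // => /eqP ->.
Qed.

Fact cayley_sym (g h : G) : cayley_adj g h -> cayley_adj h g.
Proof.
move=> /cayley_adjP[Sg gh]; apply/cayley_adjP; split; last exact/nesym.
by have := gens_sym Sg; rewrite invgM invgK.
Qed.

Fact cayley_irrefl (g : G) : ~ cayley_adj g g.
Proof. by move=> /cayley_adjP[]. Qed.

Fact cayley_locally_finite (g : G) : finite_set [set h | cayley_adj g h].
Proof.
apply: (sub_finite_set _ (finite_image (mulg g) (gens_finite S))).
by move=> h /= /cayley_adjP[Sg _]; exists (g^-1 * h)%g => //; rewrite mulKVg.
Qed.

Fact cayley_connected (g h : G) : clos_refl_trans G cayley_adj g h.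
Proof.
have [n [w [_ Sw gw]]] := gens_gen S (g^-1 * h)%g.
have {gw} -> : h = (g * \prod_(s <- w) s)%g by rewrite -gw mulKVg.
elim: w g Sw => [|s w IH] g Sw; first by rewrite big_nil mulg1; exact: rt_refl.
rewrite big_cons mulgA.
apply: (rt_trans _ _ _ (g * s)%g); last first.
  by apply: IH => s' s'w; apply: Sw; rewrite inE s'w orbT.
have [gs|gs] := pselect (g = (g * s)%g); first by rewrite -gs; exact: rt_refl.
by apply/rt_step/cayley_adjP; rewrite mulKg; split=> //; apply: Sw; rewrite inE eqxx.
Qed.

Definition cayley : graph :=
  Graph cayley_sym cayley_irrefl cayley_locally_finite cayley_connected
    (inhabits 1%g).

End Cayley.

Section FreeGroup.
Variable A : choiceType.

(* The letter [(a, b)] is the generator [a] if [b], and its inverse if not. *)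
Definition letter : Type := (A * bool)%type.
Definition linv (x : letter) : letter := (x.1, ~~ x.2).
Definition reduced (w : seq letter) : bool :=
  sorted (fun x y : letter => y != linv x) w.

Record free_group := FreeGroup { fg_word :> seq letter; _ : reduced fg_word }.
HB.instance Definition _ := [isSub for fg_word].
HB.instance Definition _ := [Choice of free_group by <:].

Definition push (x : letter) (w : seq letter) : seq letter :=
  if w is y :: w' then if y == linv x then w' else x :: w else [:: x].
Definition rmul (u v : seq letter) : seq letter := foldr push v u.
Definition rinv (u : seq letter) : seq letter := rev (map linv u).

Lemma linvK : involutive linv.
Proof. by case=> a b; rewrite /linv /= negbK. Qed.

Lemma push_reduced x w : reduced w -> reduced (push x w).
Proof.
case: w => [//|y w] /= yw; case: eqP => [_|/eqP xy]; first exact: path_sorted yw.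
by rewrite /reduced /= xy.
Qed.

Lemma rmul_reduced u v : reduced v -> reduced (rmul u v).
Proof. by move=> rv; elim: u => [//|x u IH]; exact: push_reduced. Qed.

Lemma pushK x w : reduced w -> push x (push (linv x) w) = w.
Proof.
case: w => [|y w]; first by rewrite /= eqxx.
rewrite /reduced /= linvK; case: eqP => [->|_ _]; last by rewrite /= eqxx.
by case: w => [//|z w] /= /andP[/negbTE ->].
Qed.

Lemma rmul_push x u v : reduced v -> rmul (push x u) v = push x (rmul u v).
Proof.
by move=> rv; case: u => [//|y u] /=; case: eqP => [->|//]; rewrite pushK ?rmul_reduced.
Qed.

Lemma rmulA u v w : reduced w -> rmul u (rmul v w) = rmul (rmul u v) w.
Proof. by move=> rw; elim: u => [//|x u IH] /=; rewrite IH rmul_push. Qed.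

Lemma rmul1 u : reduced u -> rmul u [::] = u.
Proof.
elim: u => [//|x u IH] xu /=; rewrite IH; last exact: path_sorted xu.
by case: u xu {IH} => [//|y u] /= /andP[/negbTE ->].
Qed.

Lemma rinv_reduced u : reduced u -> reduced (rinv u).
Proof.
rewrite /reduced /rinv rev_sorted sorted_map; apply: sub_sorted => x y /=.
by apply: contraNN => /eqP ->; rewrite linvK.
Qed.

Lemma rinvK : involutive rinv.
Proof. by move=> u; rewrite /rinv map_rev revK mapK //; exact: linvK. Qed.

Lemma rmulV u : reduced u -> rmul (rinv u) u = [::].
Proof.
elim: u => [//|x u IH] xu; rewrite /rinv /= rev_cons /rmul foldr_rcons /= linvK eqxx.
exact: IH (path_sorted xu).
Qed.

Definition fg_mul (u v : free_group) : free_group :=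
  FreeGroup (rmul_reduced u (valP v)).
Definition fg_one : free_group := @FreeGroup [::] isT.
Definition fg_inv (u : free_group) : free_group :=
  FreeGroup (rinv_reduced (valP u)).

Fact fg_mulA : associative fg_mul.
Proof. by move=> u v w; apply/val_inj/rmulA/valP. Qed.
Fact fg_mul1g : left_id fg_one fg_mul.
Proof. by move=> u; exact/val_inj. Qed.
Fact fg_mulg1 : right_id fg_one fg_mul.
Proof. by move=> u; apply/val_inj/rmul1/valP. Qed.
Fact fg_mulVg : left_inverse fg_one fg_inv fg_mul.
Proof. by move=> u; apply/val_inj/rmulV/valP. Qed.
Fact fg_mulgV : right_inverse fg_one fg_inv fg_mul.
Proof.
move=> u; apply/val_inj.
by have := rmulV (rinv_reduced (valP u)); rewrite rinvK.
Qed.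

HB.instance Definition _ := isGroup.Build free_group
  fg_mulA fg_mul1g fg_mulg1 fg_mulVg fg_mulgV.

End FreeGroup.

Section SpecialLinear.
Variable n : nat.

Record SLZ := MakeSLZ { SLZ_mx :> 'M[int]_n; _ : \det SLZ_mx == 1 }.
HB.instance Definition _ := [isSub for SLZ_mx].
HB.instance Definition _ := [Choice of SLZ by <:].

Fact SLZ_mul_subproof (A B : SLZ) : \det (val A *m val B) == 1.
Proof. by rewrite det_mulmx (eqP (valP A)) (eqP (valP B)) mulr1. Qed.
Fact SLZ_one_subproof : \det (1%:M : 'M[int]_n) == 1.
Proof. by rewrite det1. Qed.
(* For a matrix of determinant 1, the inverse is the adjugate. *)
Fact SLZ_inv_subproof (A : SLZ) : \det (\adj (val A)) == 1.
Proof.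
by have := congr1 determinant (mul_mx_adj (val A));
  rewrite det_mulmx (eqP (valP A)) mul1r det1 => ->.
Qed.

Definition SLZ_mul (A B : SLZ) : SLZ := MakeSLZ (SLZ_mul_subproof A B).
Definition SLZ_one : SLZ := MakeSLZ SLZ_one_subproof.
Definition SLZ_inv (A : SLZ) : SLZ := MakeSLZ (SLZ_inv_subproof A).

Fact SLZ_mulA : associative SLZ_mul.
Proof. by move=> A B C; apply/val_inj/mulmxA. Qed.
Fact SLZ_mul1g : left_id SLZ_one SLZ_mul.
Proof. by move=> A; apply/val_inj/mul1mx. Qed.
Fact SLZ_mulg1 : right_id SLZ_one SLZ_mul.
Proof. by move=> A; apply/val_inj/mulmx1. Qed.
Fact SLZ_mulVg : left_inverse SLZ_one SLZ_inv SLZ_mul.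
Proof. by move=> A; apply/val_inj; rewrite /= mul_adj_mx (eqP (valP A)). Qed.
Fact SLZ_mulgV : right_inverse SLZ_one SLZ_inv SLZ_mul.
Proof. by move=> A; apply/val_inj; rewrite /= mul_mx_adj (eqP (valP A)). Qed.

HB.instance Definition _ := isGroup.Build SLZ
  SLZ_mulA SLZ_mul1g SLZ_mulg1 SLZ_mulVg SLZ_mulgV.

End SpecialLinear.

Definition F2 : groupType := free_group 'I_2.
(* The multiplicative group structure on ['Z_2] is the addition modulo 2. *)
Definition F2xF2xZ2 : groupType := (F2 * F2 * 'Z_2)%type.
Definition SL4Z : groupType := SLZ 4.

(* Main.v *)
(* Let [z] be a central involution of [G] and embed [F2 * F2] in [G], its image
   meeting the subgroup [{1, z}] trivially. Write [t = (a, a)], [b = (c, 1)], [y = (1, c)]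
   with [a], [c] the generators of [F2], and take a generating set of [G] consisting of
   the tight generators [t], [b], [y] and their inverses, and of a [z]-invariant set of
   loose generators. The Cayley graph [X] is a two-fold covering of a Cayley graph of
   [G / z], except that over the loose edges it is a complete bipartite graph on the two
   fibres: hence twisting the tight edges by a cocycle with values in [{1, z}] changes [X]
   into a graph [Y] that is indistinguishable from [X] wherever the cocycle is a
   coboundary. The subgroup generated by [t], [b], [y] is not finitely presented: it is
   defined by the relations that [t ^ i b t ^ - i] and [t ^ j y t ^ - j] commute for all [i]
   and [j]. The cocycle on it that violates these relations exactly when [i - j = k] is a
   coboundary on all balls that are small compared with [k], so that [Y] is [R]-locally
   [X], but it is not a coboundary on the whole subgroup. A covering [X -> Y] would send
   the closed walks of a given length injectively to closed walks, whereas [Y] has fewer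
   of them: a walk with a loose edge closes up in half of its lifts in both graphs, while
   a tight walk with odd holonomy closes up in [X] only. *)
From Stdlib Require Import Relations.Relation_Operators.
Require Import Defs.
From mathcomp Require Import all_boot all_order all_algebra.
From mathcomp Require Import boolp classical_sets cardinality.
From mathcomp Require Import reals ereal numfun.
From mathcomp Require Import ring lra zify.

Set Implicit Arguments.
Unset Strict Implicit.
Unset Printing Implicit Defensive.

Import Order.TTheory GRing.Theory Num.Theory.

Local Open Scope classical_set_scope.
Local Open Scope ring_scope.

(** * Local isometries of balls *)

Section Transport.
Variables (K : realType) (X Y : graph) (Psi : X -> Y) (Phi : Y -> X).
Hypotheses (PsiK : cancel Psi Phi) (PhiK : cancel Phi Psi).

Definition transport (p : X -> K) : Y -> K := fun y => p (Phi y).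

Lemma transport_vertex u : transport (vertex_pt K u) = vertex_pt K (Psi u).
Proof.
apply/funext => y; rewrite /transport /vertex_pt !indicE.
congr (_%:R); congr nat_of_bool.
by apply/idP/idP; rewrite !inE /=; [move=> <-; rewrite PhiK | move=> ->; rewrite PsiK].
Qed.

Lemma transport_edge u v t :
  transport (edge_pt u v t) = edge_pt (Psi u) (Psi v) t.
Proof.
have tr w y : vertex_pt K w (Phi y) = vertex_pt K (Psi w) y.
  by rewrite -transport_vertex.
by apply/funext => y; rewrite /transport /edge_pt !tr.
Qed.

End Transport.

Section Within.
Variables (K : realType) (X : graph) (d : X -> K).
Hypothesis d_lip : forall x x', adj x x' -> d x' <= d x + 1.

Lemma edge_pt_l (u v : X) (s : K) : adj u v -> edge_pt u v s u = 1 - s.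
Proof.
move=> uv; rewrite /edge_pt /vertex_pt !indicE mem_set//= memNset ?mulr1 ?mulr0 ?addr0//.
by move=> /= e; rewrite e in uv; exact: adj_irrefl uv.
Qed.

Lemma edge_pt_r (u v : X) (s : K) : adj u v -> edge_pt u v s v = s.
Proof.
move=> uv; rewrite /edge_pt /vertex_pt !indicE memNset ?mem_set//= ?mulr1 ?mulr0 ?add0r//.
by move=> /= e; rewrite e in uv; exact: adj_irrefl uv.
Qed.

Lemma edge_pt_out (u v w : X) (s : K) : edge_pt u v s w != 0 -> w = u \/ w = v.
Proof.
rewrite /edge_pt /vertex_pt !indicE => e.
have [|wu] := pselect (w = u); first by left.
have [|wv] := pselect (w = v); first by right.
by move: e; rewrite !memNset// !mulr0 addr0 eqxx.
Qed.

(* A version of [d p <= c] for the extension of [d] to the points of the edges: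
   the distance from [p] to a vertex [w] of its edge is [1 - p w]. *)
Definition within (c : K) (p : X -> K) : Prop :=
  exists w, 0 < p w /\ d w + 1 - p w <= c.

Lemma within_le c c' p : c <= c' -> within c p -> within c' p.
Proof. by move=> cc' [w [w0 wc]]; exists w; split => //; exact: le_trans cc'. Qed.

Lemma within_edge c u v s : adj u v -> 0 <= s <= 1 ->
  within c (edge_pt u v s) -> d u <= c + 1 /\ d v <= c + 1.
Proof.
move=> uv s01 [w [w0 wc]]; have l1 := d_lip uv; have l2 := d_lip (adj_sym uv).
by have [wu|wv] := edge_pt_out (lt0r_neq0 w0); subst w;
  rewrite ?edge_pt_l ?edge_pt_r// in wc; split; lra.
Qed.

(** When the point reaches the other end of the edge, the coordinate of [w] vanishes and [w] no
    longer serves as a witness. The other end then does, by the Lipschitz bound. *)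
Lemma within_move c u v s t : adj u v -> 0 <= s <= 1 -> 0 <= t <= 1 ->
  within c (edge_pt u v s) -> within (c + `|s - t|) (edge_pt u v t).
Proof.
move=> uv s01 t01 [w [w0 wc]].
have uL := edge_pt_l _ uv; have vR := edge_pt_r _ uv.
have l1 := d_lip uv; have l2 := d_lip (adj_sym uv).
have n1 := ler_norm (s - t); have n2 := ler_norm (t - s); rewrite distrC in n2.
have [wu|wv] := edge_pt_out (lt0r_neq0 w0); subst w;
  rewrite ?uL ?vR in w0 wc.
- have [t1|t1] := ltP t 1; first by exists u; rewrite uL; split; lra.
  by exists v; rewrite vR; split; lra.
- have [t0|t0] := ltP 0 t; first by exists v; rewrite vR; split; lra.
  by exists u; rewrite uL; split; lra.
Qed.

Lemma between01 (s t r : K) : 0 <= s <= 1 -> 0 <= t <= 1 ->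
  Num.min s t <= r <= Num.max s t -> 0 <= r <= 1 /\ `|s - r| <= `|s - t|.
Proof.
move=> s01 t01; have [st|ts] := leP s t => r01.
  rewrite (ler0_norm (x := s - r)) ?(ler0_norm (x := s - t)); by [split; lra|lra].
rewrite (ger0_norm (x := s - r)) ?(ger0_norm (x := s - t)); by [split; lra|lra].
Qed.

Lemma pl_path_ge0 (A : set (X -> K)) p q l : pl_path A p q l -> 0 <= l.
Proof. by elim=> // *; rewrite addr_ge0. Qed.

Lemma pl_path_within (A : set (X -> K)) c p q l : pl_path A p q l ->
  within c p -> pl_path [set r | A r /\ within (c + l) r] p q l.
Proof.
move=> pq; elim: pq c => {p q l} [p Ap|u v s t q l uv s01 t01 stA tq IH] c wp.
  by apply: pl_nil; split=> //; rewrite addr0.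
have wt := within_move uv s01 t01 wp.
apply: pl_cons => //; last by rewrite addrA; exact: IH.
move=> r rst; split; first exact: stA.
have [r01 sr] := between01 s01 t01 rst.
apply: within_le (within_move uv s01 r01 wp).
have := pl_path_ge0 tq; lra.
Qed.

Lemma pl_path_end (A : set (X -> K)) p q l : pl_path A p q l -> A q.
Proof. by elim. Qed.

End Within.

Section TransportPath.
Variables (K : realType) (X Y : graph) (Psi : X -> Y) (Phi : Y -> X).
Hypotheses (PsiK : cancel Psi Phi) (PhiK : cancel Phi Psi).
Variables (d : X -> K) (N : K).
Hypothesis d_lip : forall x x', adj x x' -> d x' <= d x + 1.
Hypothesis Psi_adj :
  forall x x', d x <= N -> d x' <= N -> adj x x' -> adj (Psi x) (Psi x').
Local Notation tr := (@transport K X Y Phi).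

Lemma transport_realization c p : c + 1 <= N ->
  realization p -> within d c p -> realization (tr p).
Proof.
move=> cN [[u ->] _|[u [v [t [uv t01 ->]]]] wc].
  by left; exists (Psi u); rewrite (transport_vertex K PsiK PhiK).
right; exists (Psi u), (Psi v), t; split=> //; last by rewrite -(transport_edge PsiK PhiK).
by have [? ?] := within_edge d_lip uv t01 wc; apply: Psi_adj => //; lra.
Qed.

Lemma transport_path (A : set (X -> K)) (B : set (Y -> K)) c p q l : c + 1 <= N ->
  (forall r, A r -> within d c r /\ B (tr r)) ->
  pl_path A p q l -> pl_path B (tr p) (tr q) l.
Proof.
move=> cN AB; elim=> {p q l} [p Ap|u v s t q l uv s01 t01 stA tq IH].
  by apply: pl_nil; case: (AB _ Ap).
rewrite !(transport_edge PsiK PhiK) in IH *.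
have [|ws _] := AB _ (stA s _); first by rewrite ge_min le_max lexx.
apply: pl_cons => //; last first.
  by move=> r /stA/AB[_]; rewrite (transport_edge PsiK PhiK).
by have [? ?] := within_edge d_lip uv s01 ws; apply: Psi_adj => //; lra.
Qed.

Variables (x0 : X) (R : K).
Hypothesis d0 : d x0 = 0.

Lemma within_x0 : within d 0 (vertex_pt K x0).
Proof.
exists x0; rewrite /vertex_pt indicE mem_set//= d0; split; lra.
Qed.

Lemma path_of_dist (A : set (X -> K)) p q e : 0 < e ->
  (intrinsic_dist A p q <= R%:E)%E -> exists2 l, l < R + e & pl_path A p q l.
Proof.
move=> e0 dR; have : (intrinsic_dist A p q < (R + e)%:E)%E.
  by apply: le_lt_trans dR _; rewrite lte_fin ltrDl.
by case/ereal_inf_lt => _ [l /= pl <-]; rewrite lte_fin; exists l.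
Qed.

(** The infimum that defines the distance is only approximated by paths, hence [R + 1] in place of
    [R]. *)
Lemma gball_within p : gball x0 R p -> within d (R + 1) p.
Proof.
move=> [_ /(path_of_dist (@ltr01 K))[l lR pl]].
have [_ wp] := pl_path_end (pl_path_within d_lip pl within_x0).
by apply: within_le wp; lra.
Qed.

End TransportPath.


Section LocalIsometry.
Variables (K : realType) (X Y : graph) (Psi : X -> Y) (Phi : Y -> X).
Hypotheses (PsiK : cancel Psi Phi) (PhiK : cancel Phi Psi).
Variables (d : X -> K) (N : K).
Hypothesis dX_lip : forall x x', adj x x' -> d x' <= d x + 1.
Hypothesis Psi_adj : forall x x', d x <= N -> d x' <= N ->
  adj x x' <-> adj (Psi x) (Psi x').
Variables (x0 : X) (R : K).
Hypotheses (d0 : d x0 = 0) (RN : R + 1 + 1 <= N).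

Let Psi_hom x x' : d x <= N -> d x' <= N -> adj x x' -> adj (Psi x) (Psi x').
Proof. by move=> dx dx' /Psi_adj; apply. Qed.

Lemma transport_gball p :
  gball x0 R p -> gball (Psi x0) R (@transport K X Y Phi p).
Proof.
move=> Bp; have wp := gball_within dX_lip d0 Bp; case: Bp => rp dp; split.
  by apply: (transport_realization PsiK PhiK dX_lip Psi_hom RN rp wp).
apply/lee_addgt0Pr => e e0.
(* Capping the slack at 1 keeps the approximating path within [R + 1], where [Psi] still preserves
   adjacency. *)
have e'0 : 0 < Num.min e 1 by rewrite lt_min e0 ltr01.
have [l lR pl] := path_of_dist e'0 dp.
have [le1 lee] : l <= R + 1 /\ l <= R + e.
  by split; apply: le_trans (ltW lR) _; rewrite lerD2l ge_min lexx ?orbT.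
rewrite -EFinD; apply: ge_ereal_inf; exists l%:E => /=; last by rewrite lee_fin.
exists l => //; rewrite -(transport_vertex K PsiK PhiK).
have pl' := pl_path_within dX_lip pl (within_x0 d0).
apply: (transport_path (c := R + 1) PsiK PhiK dX_lip Psi_hom RN _ pl').
move=> r [rr wr]; have wr' : within d (R + 1) r by apply: within_le wr; lra.
split=> //; apply: (transport_realization PsiK PhiK dX_lip Psi_hom RN rr wr').
Qed.

Lemma transport_gball_path p q l : pl_path (gball x0 R) p q l ->
  pl_path (gball (Psi x0) R) (@transport K X Y Phi p) (transport Phi q) l.
Proof.
apply: (transport_path (c := R + 1) PsiK PhiK dX_lip Psi_hom RN).
by move=> r Br; split; [exact: (gball_within dX_lip d0)|exact: transport_gball].
Qed.

End LocalIsometry.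

(** In both graphs [d] bounds the distance to the centre from below, so paths that stay close to the
    centre use only edges that [Psi] and [Phi] preserve. Of the two units in [R + 1 + 1], one is for
    the approximated infimum, the other for the far end of an edge that is met only in part. *)
Lemma gball_isometric (K : realType) (X Y : graph) (Psi : X -> Y) (Phi : Y -> X)
    (d : X -> K) (N : K) (x0 : X) (R : K) :
  cancel Psi Phi -> cancel Phi Psi ->
  (forall x x', adj x x' -> d x' <= d x + 1) ->
  (forall y y', adj y y' -> d (Phi y') <= d (Phi y) + 1) ->
  (forall x x', d x <= N -> d x' <= N -> adj x x' <-> adj (Psi x) (Psi x')) ->
  d x0 = 0 -> R + 1 + 1 <= N ->
  isometric (gball x0 R) (gball (Psi x0) R).
Proof.
move=> PsiK PhiK dX dY adjP d0 RN.
have dX' x x' : adj x x' -> d (Phi (Psi x')) <= d (Phi (Psi x)) + 1.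
  by rewrite !PsiK; exact: dX.
have adjP' y y' : d (Phi y) <= N -> d (Phi y') <= N ->
    adj y y' <-> adj (Phi y) (Phi y').
  by move=> *; rewrite adjP// !PhiK.
have d0' : d (Phi (Psi x0)) = 0 by rewrite PsiK.
have trK : cancel (@transport K X Y Phi) (transport Psi).
  by move=> p; apply/funext => x; rewrite /transport PsiK.
have trK' : cancel (@transport K Y X Psi) (transport Phi).
  by move=> p; apply/funext => x; rewrite /transport PhiK.
have tY p : gball (Psi x0) R p -> gball x0 R (@transport K Y X Psi p).
  by move=> /(transport_gball PhiK PsiK dY adjP' d0' RN); rewrite PsiK.
exists (transport Phi); split.
  split=> [p|p q _ _|p Bp]; first exact: (transport_gball PsiK PhiK dX adjP).
    exact: can_inj trK _ _.
  by exists (transport Psi p) => //; exact: tY.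
move=> p q _ _; rewrite /intrinsic_dist; congr (ereal_inf (EFin @` _)).
apply/seteqP; split=> l /=; last exact: (transport_gball_path PsiK PhiK dX adjP).
move=> /(transport_gball_path PhiK PsiK dY adjP' d0' RN).
by rewrite !trK PsiK.
Qed.

(** * Twisted Cayley graphs *)

Section WordLength.
Variables (G : groupType) (S : gen_set G).
Local Open Scope group_scope.

Lemma word_length_le n g : product_of_length (gens S) n g -> (word_length S g <= n)%N.
Proof. by rewrite /word_length; case: ex_minnP => m _ mn gn; apply: mn; apply/asboolP. Qed.

Lemma word_lengthP g : product_of_length (gens S) (word_length S g) g.
Proof. by rewrite /word_length; case: ex_minnP => m /asboolP. Qed.

Lemma word_length1 : word_length S 1 = 0%N.
Proof.
apply/eqP; rewrite -leqn0; apply: word_length_le.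
by exists [::]; rewrite big_nil.
Qed.

Lemma word_length_mulr g s : gens S s -> (word_length S (g * s) <= (word_length S g).+1)%N.
Proof.
have [w [sw Sw gw]] := word_lengthP g => Ss.
apply: word_length_le; exists (rcons w s); split.
- by rewrite size_rcons sw.
- by move=> t; rewrite mem_rcons inE => /predU1P[->//|/Sw].
- by rewrite -cats1 big_cat big_seq1 -gw.
Qed.

Lemma word_length_finite n : finite_set [set g | (word_length S g <= n)%N].
Proof.
have pf m : finite_set (product_of_length (gens S) m).
  elim: m => [|m IH].
    apply: (sub_finite_set _ (finite_set1 1)) => g [w [/size0nil -> _ ->]].
    by rewrite big_nil.
  apply: (sub_finite_set _ (finite_image (fun p => p.1 * p.2)
    (finite_setX (gens_finite S) IH))).
  move=> g [[|s w] [sw Sw ->]] //; case: sw => sw.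
  rewrite big_cons; exists (s, \prod_(t <- w) t) => //.
  split; first by apply: Sw; rewrite inE eqxx.
  by exists w; split=> // t tw; apply: Sw; rewrite inE tw orbT.
apply: (sub_finite_set (B := \bigcup_(m in `I_n.+1) product_of_length (gens S) m)).
  by move=> g gn; exists (word_length S g) => //; exact: word_lengthP.
by apply: bigcup_finite => //; exact: finite_II.
Qed.

End WordLength.

Section Twist.
Variables (G : groupType) (z : G).
Local Open Scope group_scope.
Hypotheses (zz : z * z = 1) (zC : forall g, z * g = g * z).

Lemma zb_mul (b c : bool) : z ^+ b * z ^+ c = z ^+ (b (+) c).
Proof. by case: b c => -[]; rewrite ?expg0 ?expg1 ?mulg1 ?mul1g ?zz. Qed.
Lemma zbC (b : bool) g : z ^+ b * g = g * z ^+ b.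
Proof. by case: b; rewrite ?expg0 ?expg1 ?mulg1 ?mul1g ?zC. Qed.
Lemma zbK (b : bool) g : g * z ^+ b * z ^+ b = g.
Proof. by rewrite -mulgA zb_mul addbb mulg1. Qed.
Lemma zbV (b : bool) : (z ^+ b)^-1 = z ^+ b.
Proof. by apply: mulg1_eq; rewrite zb_mul addbb. Qed.

Variables T0 T1 U : seq G.
Hypotheses (T0V : forall s, s \in T0 -> s^-1 \in T0)
  (T1V : forall s, s \in T1 -> s^-1 \in T1)
  (UV : forall s, s \in U -> s^-1 \in U)
  (Uz : forall s, s \in U -> s * z \in U).
Hypotheses (T01 : 1 \notin T0) (T11 : 1 \notin T1) (T1z : z \notin T1) (U1 : 1 \notin U).
Hypotheses (T1U : forall s, s \in T1 -> s \notin U)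
  (T0U : forall s, s \in T0 -> s \notin U)
  (T1T0 : forall s, s \in T1 -> s \notin T0)
  (T1zT0 : forall s, s \in T1 -> s * z \notin T0).
Hypothesis T_prod : forall w, {subset w <= T0 ++ T1} -> \prod_(s <- w) s != z.
Variable u0 : G.
Hypothesis u0U : u0 \in U.

Let gensT : set G := [set s | s \in U ++ T0 ++ T1].
Hypothesis gensT_gen : forall g, exists n, product_of_length gensT n g.

Lemma Uzb (b : bool) s : s \in U -> s * z ^+ b \in U.
Proof. by case: b; rewrite ?expg0 ?mulg1 ?expg1 => //; exact: Uz. Qed.

Fact gensT_finite : finite_set gensT.
Proof. exact: finite_seq. Qed.

Fact gensT_sym s : gensT s -> gensT s^-1.
Proof.
rewrite /gensT /= !mem_cat => /or3P[/UV|/T0V|/T1V] ->; by rewrite ?orbT.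
Qed.

Definition twist_gen_set : gen_set G :=
  GenSet gensT_finite gensT_sym gensT_gen.

Section Nu.
Variable nu : G -> bool.
Hypotheses (nuz : forall g, nu (g * z) = nu g)
  (nuT : forall g s, s \in T1 -> nu (g * s) = nu g).

Lemma nuzb (b : bool) g : nu (g * z ^+ b) = nu g.
Proof. by case: b; rewrite ?expg0 ?mulg1 ?expg1. Qed.

(** Only the edges labelled in [T1] are twisted. The relation is symmetric because [nu] takes the
    same value at both ends of such an edge. *)
Definition twist_adj (g h : G) : Prop :=
  [|| g^-1 * h \in U, g^-1 * h \in T0 | g^-1 * h * z ^+ nu g \in T1].

Fact twist_sym g h : twist_adj g h -> twist_adj h g.
Proof.
have e : h^-1 * g = (g^-1 * h)^-1 by rewrite invgM invgK.
rewrite /twist_adj => /or3P[/UV|/T0V|hT]; rewrite e.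
- by move=> ->.
- by move=> ->; rewrite orbT.
have -> : nu h = nu g.
  by rewrite -(nuT g hT) mulgA mulVKg nuzb.
by rewrite -[in X in _ || X]zbV -invgM zbC T1V ?orbT.
Qed.

Fact twist_irrefl g : ~ twist_adj g g.
Proof.
rewrite /twist_adj mulVg mul1g (negbTE U1) (negbTE T01) /=.
by case: (nu g); rewrite ?expg0 ?expg1 (negbTE T1z, negbTE T11).
Qed.

Fact twist_locally_finite g : finite_set [set h | twist_adj g h].
Proof.
pose L := [seq g * s | s <- U ++ T0 ++ [seq s * z ^+ nu g | s <- T1]].
apply: (sub_finite_set (B := [set` L])); last exact: finite_seq.
move=> h /= gh; apply/mapP; exists (g^-1 * h); last by rewrite mulVKg.
rewrite !mem_cat; case/or3P: gh => [->//|->|hT]; first by rewrite orbT.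
by apply/orP; right; apply/orP; right; apply/mapP; exists (g^-1 * h * z ^+ nu g) => //; rewrite zbK.
Qed.

Lemma twist_adjU g s : s \in U -> twist_adj g (g * s).
Proof. by move=> sU; rewrite /twist_adj mulKg sU. Qed.

(** The loose letters [u0] and [u0^-1 * z] lead from [a] to [a * z], which repairs the factor [z] of
    a twisted edge. *)
Fact twist_connected g h : clos_refl_trans G twist_adj g h.
Proof.
have cz a : clos_refl_trans G twist_adj a (a * z).
  apply: (rt_trans _ _ _ (a * u0)); first exact/rt_step/twist_adjU.
  have -> : a * z = a * u0 * (u0^-1 * z) by rewrite mulgA mulgK.
  exact/rt_step/twist_adjU/Uz/UV.
have cs a s : gensT s -> clos_refl_trans G twist_adj a (a * s).
  rewrite /gensT /= !mem_cat => /or3P[sU|sT|sT].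
  - exact/rt_step/twist_adjU.
  - by apply: rt_step; rewrite /twist_adj mulKg sT orbT.
  apply: (rt_trans _ _ _ (a * s * z ^+ nu a)).
    by apply: rt_step; rewrite /twist_adj -mulgA mulKg zbK sT !orbT.
  case: (nu a); last by rewrite expg0 mulg1; exact: rt_refl.
  by rewrite expg1; have := cz (a * s * z); rewrite -(mulgA _ z) zz mulg1.
have [n [w [_ Sw gw]]] := gensT_gen (g^-1 * h).
have {gw} -> : h = g * \prod_(s <- w) s by rewrite -gw mulVKg.
elim: w g Sw => [|s w IH] g Sw; first by rewrite big_nil mulg1; exact: rt_refl.
rewrite big_cons mulgA; apply: (rt_trans _ _ _ (g * s)).
  by apply: cs; apply: Sw; rewrite inE eqxx.
by apply: IH => t tw; apply: Sw; rewrite inE tw orbT.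
Qed.

Definition twist_graph : graph :=
  Graph twist_sym twist_irrefl twist_locally_finite twist_connected
    (inhabits 1).

End Nu.

Local Notation X := (cayley twist_gen_set).

Lemma cayley_adjE g h : cayley_adj twist_gen_set g h <-> g^-1 * h \in U ++ T0 ++ T1.
Proof.
split=> [/cayley_adjP[]//|gh]; apply/cayley_adjP; split=> // e.
move: gh; rewrite e mulVg !mem_cat.
by rewrite (negbTE U1) (negbTE T01) (negbTE T11).
Qed.

(** * Gauge transformations and the balls of the twisted graph *)

Section Local.
Variables (nu : G -> bool).
Hypotheses (nuz : forall g, nu (g * z) = nu g)
  (nuT : forall g s, s \in T1 -> nu (g * s) = nu g).
Local Notation Y := (twist_graph nuz nuT).
Variables (g0 : G) (n : nat) (phi : G -> bool).
Let wl g := word_length twist_gen_set g.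
(** A distance modulo [z]: it does not change under [gauge], hence it is 1-Lipschitz for both
    graphs. *)
Let d g := minn (wl (g0^-1 * g)) (wl (g0^-1 * g * z)).
Hypotheses (phiz : forall g, phi (g * z) = phi g)
  (phiT0 : forall g s, s \in T0 -> phi (g * s) = phi g)
  (phiT1 : forall g s, (d g <= n)%N -> s \in T1 -> phi (g * s) = phi g (+) nu g).

Let phizb (b : bool) g : phi (g * z ^+ b) = phi g.
Proof. by case: b; rewrite ?expg0 ?mulg1 ?expg1. Qed.

Definition gauge g := g * z ^+ phi g.

Lemma gaugeK : cancel gauge gauge.
Proof. by move=> g; rewrite /gauge phizb zbK. Qed.

(** Gauging multiplies [g^-1 * h] by [z ^+ (phi g (+) phi h)]. Loose edges do not see this factor;
    on tight edges it is exactly the twist, by [phiT0] and [phiT1]. *)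
Lemma gauge_adj g h : (d g <= n)%N ->
  cayley_adj twist_gen_set g h <-> twist_adj nu (gauge g) (gauge h).
Proof.
move=> dg; rewrite cayley_adjE /twist_adj.
have -> : (gauge g)^-1 * gauge h = g^-1 * h * z ^+ (phi g (+) phi h).
  by rewrite /gauge invgM zbV addbC -zb_mul (zbC _ g^-1) -!mulgA (mulgA _ h) (zbC _ h) -!mulgA zbC.
rewrite -(mulgA _ (z ^+ _) (z ^+ _)) zb_mul /gauge (nuzb nuz) !mem_cat.
have UE (b : bool) s : (s * z ^+ b \in U) = (s \in U).
  by apply/idP/idP => [/(Uzb b)|/Uzb//]; rewrite zbK.
rewrite UE.
split=> /or3P[->//|hT|hT].
- suff -> : phi h = phi g by rewrite addbb expg0 mulg1 hT orbT.
  by rewrite -(phiT0 g hT) mulVKg.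
- suff -> : phi h = phi g (+) nu g.
    by rewrite addKb addbb expg0 mulg1 hT !orbT.
  by rewrite -(phiT1 dg hT) mulVKg.
- suff e : phi h = phi g by move: hT; rewrite e addbb expg0 mulg1 => ->; rewrite orbT.
  by rewrite -(phiT0 g hT) mulgA mulVKg phizb.
- suff e : phi h = phi g (+) nu g.
    by move: hT; rewrite e addKb addbb expg0 mulg1 => ->; rewrite !orbT.
  by rewrite -(phiT1 dg hT) mulgA mulVKg phizb.
Qed.

Let dz (b : bool) g : d (g * z ^+ b) = d g.
Proof.
case: b; last by rewrite expg0 mulg1.
have e x : x * z * z = x by rewrite -mulgA zz mulg1.
by rewrite expg1 /d !mulgA e minnC.
Qed.

Let d_mulr g s : gensT s -> (d (g * s) <= (d g).+1)%N.
Proof.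
move=> Ss; rewrite /d.
have -> : g0^-1 * (g * s) * z = g0^-1 * g * z * s by rewrite -!mulgA zC.
rewrite (mulgA _ g s).
have := word_length_mulr (S := twist_gen_set) (g0^-1 * g) Ss.
have := word_length_mulr (S := twist_gen_set) (g0^-1 * g * z) Ss.
by rewrite /wl => l1 l2; rewrite -minnSS leq_min !geq_min l1 l2 orbT.
Qed.

Lemma gauge_isometric (K : realType) (R : K) : R + 1 + 1 <= n%:R ->
  isometric (@gball K X g0 R) (@gball K Y (gauge g0) R).
Proof.
move=> Rn; apply: (@gball_isometric K X Y gauge gauge (fun g => (d g)%:R) n%:R) => //.
- exact: gaugeK.
- exact: gaugeK.
- move=> g h /cayley_adjE gh; rewrite -(mulVKg g h) natr1 ler_nat.
  exact: d_mulr.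
- move=> g h gh; rewrite natr1 ler_nat /gauge !dz.
  case/or3P: gh => [gh|gh|gh].
  + by rewrite -(mulVKg g h); apply: d_mulr; rewrite /gensT /= mem_cat gh.
  + by rewrite -(mulVKg g h); apply: d_mulr; rewrite /gensT /= !mem_cat gh orbT.
  + rewrite -(dz (nu g) h) -(mulVKg g (h * _)) (mulgA g^-1).
    by apply: d_mulr; rewrite /gensT /= !mem_cat gh !orbT.
- by move=> g h; rewrite !ler_nat => dg _; exact: gauge_adj.
- by rewrite /d mulVg /wl word_length1 min0n.
Qed.

End Local.

(** * Comparison of closed walks in the two graphs *)

Section NotCovered.
Variables (nu : G -> bool).
Hypotheses (nuz : forall g, nu (g * z) = nu g)
  (nuT : forall g s, s \in T1 -> nu (g * s) = nu g).
Local Notation Y := (twist_graph nuz nuT).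

(** The exponent of [z] by which the end of the twisted walk labelled by [w] differs from the end of
    the untwisted one, see [twist_walk]. *)
Fixpoint holonomy (g : G) (w : seq G) : bool :=
  if w is s :: w' then (nu g && (s \in T1)) (+) holonomy (g * s) w' else false.

Definition twist_step (g s : G) : G := g * s * z ^+ (nu g && (s \in T1)).

Lemma holonomyz (b : bool) g w : holonomy (g * z ^+ b) w = holonomy g w.
Proof.
elim: w g => // s w IH g /=; rewrite (nuzb nuz) -mulgA zbC mulgA.
by rewrite IH.
Qed.

Lemma twist_walk g w :
  foldl twist_step g w = g * \prod_(s <- w) s * z ^+ holonomy g w.
Proof.
elim: w g => [|s w IH] g /=; first by rewrite big_nil !mulg1.
rewrite IH /twist_step holonomyz big_cons -zb_mul -!mulgA; congr (_ * (_ * _)).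
by rewrite !mulgA zbC.
Qed.

(** Flipping the first loose letter multiplies the product by [z] and keeps the holonomy, since
    loose letters are not twisted and [nu] ignores [z]. A tight word is fixed. *)
Fixpoint flip (w : seq G) : seq G :=
  if w is s :: w' then if s \in U then s * z :: w' else s :: flip w' else [::].

Lemma flipK : involutive flip.
Proof.
elim=> //= s w IH; case: ifP => sU /=; last by rewrite sU IH.
by rewrite Uz// -mulgA zz mulg1.
Qed.

Lemma size_flip w : size (flip w) = size w.
Proof. by elim: w => //= s w; case: ifP => //= _ ->. Qed.

Lemma flip_gens w : {subset w <= U ++ T0 ++ T1} -> {subset flip w <= U ++ T0 ++ T1}.
Proof.
elim: w => //= s w IH ws; have sS : s \in U ++ T0 ++ T1 by apply: ws; rewrite inE eqxx.
have {}ws : {subset w <= U ++ T0 ++ T1} by move=> t tw; apply: ws; rewrite inE tw orbT.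
case: ifP => sU t; rewrite inE => /predU1P[->//|].
- by rewrite mem_cat Uz.
- exact: ws.
- exact: IH.
Qed.

Lemma holonomy_flip g w : holonomy g (flip w) = holonomy g w.
Proof.
elim: w g => //= s w IH g; case: ifP => sU /=; last by rewrite IH.
have -> : (s * z \in T1) = false by apply/negP => /T1U; rewrite Uz.
have -> : (s \in T1) = false by apply/negP => /T1U; rewrite sU.
by rewrite mulgA -(expg1 z) (holonomyz true).
Qed.

Lemma prod_flip w : has [in U] w -> \prod_(s <- flip w) s = z * \prod_(s <- w) s.
Proof.
elim: w => //= s w IH; case: ifP => sU /=; rewrite !big_cons.
  by rewrite -zC mulgA.
by move=> /IH ->; rewrite !mulgA zC.
Qed.

Lemma flip_T w : {subset w <= T0 ++ T1} -> flip w = w.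
Proof.
elim: w => //= s w IH wT; have := wT s; rewrite mem_cat mem_head => /(_ isT) sT.
rewrite ifN ?IH// => [t tw|]; first by apply: wT; rewrite inE tw orbT.
by case/orP: sT => [/T0U|/T1U].
Qed.

(** On an edge of the twisted graph, [g^-1 * h] can fail to be a generator only if it is a letter of
    [T1] times [z]; the label is then that letter. *)
Definition label (g h : G) : G :=
  let s := g^-1 * h in if s \in U ++ T0 ++ T1 then s else s * z.

Lemma labelP g h : twist_adj nu g h ->
  label g h \in U ++ T0 ++ T1 /\ twist_step g (label g h) = h.
Proof.
rewrite /twist_adj /twist_step /label; set s := g^-1 * h.
have gs : g * s = h by rewrite mulVKg.
case/or3P => [sU|sT|sT].
- have sS : s \in U ++ T0 ++ T1 by rewrite mem_cat sU.
  rewrite sS; split=> //; have /negbTE -> : s \notin T1.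
    by apply/negP => /T1U; rewrite sU.
  by rewrite andbF mulg1.
- have sS : s \in U ++ T0 ++ T1 by rewrite !mem_cat sT orbT.
  rewrite sS; split=> //; have /negbTE -> : s \notin T1.
    by apply/negP => /T1T0; rewrite sT.
  by rewrite andbF mulg1.
case: (nu g) sT; rewrite ?expg0 ?expg1 ?mulg1 => sT.
  case: ifP => sS.
    have := T1U sT; have := T1zT0 sT; rewrite -mulgA zz mulg1.
    move: sS; rewrite !mem_cat => /or3P[/Uz ->//|->//|sT'] _ _.
    (* [s] and [s * z] are not both tight, as their quotient would be [z]. *)
    exfalso; have := T_prod (w := [:: s^-1; s * z]).
    rewrite !big_cons big_nil mulg1 mulKg eqxx => /(_ _)/negP; case => // t.
    by rewrite !inE mem_cat => /orP[]/eqP ->; rewrite ?T1V ?sT ?orbT.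
  rewrite !mem_cat sT !orbT; split=> //=.
  by rewrite expg1 -!mulgA zz mulg1.
by rewrite !mem_cat sT !orbT; split=> //=; rewrite sT !orbT.
Qed.

Variable f : G -> G.
Hypotheses (f1 : f 1 = 1)
  (f_adj : forall g h, g^-1 * h \in U ++ T0 ++ T1 -> twist_adj nu (f g) (f h))
  (f_inj : forall g h k, g^-1 * h \in U ++ T0 ++ T1 -> g^-1 * k \in U ++ T0 ++ T1 ->
    f h = f k -> h = k).

Fixpoint push_labels (g : G) (w : seq G) : seq G :=
  if w is s :: w' then label (f g) (f (g * s)) :: push_labels (g * s) w' else [::].

Let f_adjs g s : s \in U ++ T0 ++ T1 -> twist_adj nu (f g) (f (g * s)).
Proof. by move=> sS; apply: f_adj; rewrite mulKg. Qed.

Let subS (s : G) w : {subset s :: w <= U ++ T0 ++ T1} ->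
  s \in U ++ T0 ++ T1 /\ {subset w <= U ++ T0 ++ T1}.
Proof.
move=> ws; split; first by apply: ws; rewrite inE eqxx.
by move=> t tw; apply: ws; rewrite inE tw orbT.
Qed.

Lemma size_push_labels g w : size (push_labels g w) = size w.
Proof. by elim: w g => //= s w IH g; rewrite IH. Qed.

Lemma push_labels_gens g w : {subset w <= U ++ T0 ++ T1} ->
  {subset push_labels g w <= U ++ T0 ++ T1}.
Proof.
elim: w g => //= s w IH g /subS[sS ws] t; rewrite inE => /predU1P[->|].
  by have [] := labelP (f_adjs g sS).
exact: IH.
Qed.

Lemma walk_push_labels g w : {subset w <= U ++ T0 ++ T1} ->
  foldl twist_step (f g) (push_labels g w) = f (g * \prod_(s <- w) s).
Proof.
elim: w g => [|s w IH] g /=; first by rewrite big_nil mulg1.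
move=> /subS[sS ws]; have [_ ->] := labelP (f_adjs g sS).
by rewrite IH// big_cons mulgA.
Qed.

(** Uniqueness of path lifting: equal labels from the same start give the same walk in the image,
    and [f] is injective on the neighbours of each vertex. *)
Lemma push_labels_inj g w w' : {subset w <= U ++ T0 ++ T1} ->
  {subset w' <= U ++ T0 ++ T1} -> push_labels g w = push_labels g w' -> w = w'.
Proof.
elim: w w' g => [|s w IH] [|s' w'] g //= /subS[sS ws] /subS[sS' ws'] [ll].
have [_ e] := labelP (f_adjs g sS); have [_ e'] := labelP (f_adjs g sS').
have ff : f (g * s) = f (g * s') by rewrite -e -e' ll.
have /mulgI -> : g * s = g * s' by apply: (f_inj (g := g)) ff; rewrite mulKg.
by move=> /(IH _ _ ws ws') ->.
Qed.

Definition closed_word n (w : seq G) : Prop :=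
  [/\ size w = n, {subset w <= U ++ T0 ++ T1} & \prod_(s <- w) s = 1].

Lemma closed_word_finite n :
  exists2 L : seq (seq G), uniq L & forall w, w \in L <-> closed_word n w.
Proof.
pose ws := iter n (fun L => [seq s :: w | s <- U ++ T0 ++ T1, w <- L]) [:: [::]].
have wsP w : w \in ws <-> size w = n /\ {subset w <= U ++ T0 ++ T1}.
  rewrite /ws; elim: n {ws} w => [|n IH] w /=.
    rewrite inE; split=> [/eqP -> //|[/size0nil -> //]].
  split=> [/allpairsP[[s w'] /= [sS /IH[sw ww] ->]]|].
    split; first by rewrite /= sw.
    by move=> t; rewrite inE => /predU1P[-> //|/ww].
  case: w => [[]//|s w] [[sw] /subS[sS ww]].
  by apply/allpairsP; exists (s, w); split=> //; apply/IH.
exists (undup [seq w <- ws | \prod_(s <- w) s == 1]); first exact: undup_uniq.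
move=> w; rewrite mem_undup mem_filter; split=> [/andP[/eqP w1 /wsP[]]//|[? ? ->]].
by rewrite eqxx; apply/wsP.
Qed.

Definition unwind (w : seq G) : seq G :=
  if \prod_(s <- w) s == 1 then w else flip w.

(** The image under [f] is a closed walk of the twisted graph, so by [twist_walk] the product of its
    labels and its holonomy factor cancel. *)
Lemma closed_push w : {subset w <= U ++ T0 ++ T1} -> \prod_(s <- w) s = 1 ->
  \prod_(s <- push_labels 1 w) s = z ^+ holonomy 1 (push_labels 1 w).
Proof.
move=> ws w1; have := walk_push_labels 1 ws.
rewrite f1 twist_walk w1 mulg1 f1 mul1g => /eqP.
by rewrite mulg_eq1 zbV => /eqP.
Qed.

Lemma has_U w : {subset w <= U ++ T0 ++ T1} -> \prod_(s <- w) s = z -> has [in U] w.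
Proof.
move=> ws wz; apply: contraT => /hasPn nU; suff /T_prod : {subset w <= T0 ++ T1} by rewrite wz eqxx.
by move=> t tw; have := ws _ tw; rewrite mem_cat (negbTE (nU _ tw)).
Qed.

(* Labelling the image under [f] of a closed walk of [X], and flipping its first
   loose letter if the product of the labels is [z], is an injection between
   closed words of [X] that misses the words of [T0] and [T1] with odd holonomy. *)
Lemma twist_not_covered w0 : {subset w0 <= T0 ++ T1} -> \prod_(s <- w0) s = 1 ->
  holonomy 1 w0 -> False.
Proof.
move=> w0T w01 w0h.
have z1 : z != 1 by have := @T_prod [::]; rewrite big_nil eq_sym; apply.
have [L uL LP] := closed_word_finite (size w0).
pose F w := unwind (push_labels 1 w).
have prodL w : w \in L ->
    \prod_(s <- push_labels 1 w) s = if holonomy 1 (push_labels 1 w) then z else 1.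
  move=> /LP[sw ws w1]; rewrite closed_push//; by case: holonomy; rewrite ?expg0 ?expg1.
have FE w : w \in L ->
    F w = if holonomy 1 (push_labels 1 w) then flip (push_labels 1 w) else push_labels 1 w.
  move=> wL; rewrite /F /unwind (prodL _ wL); case: holonomy; last by rewrite eqxx.
  by rewrite (negbTE z1).
have FL w : w \in L -> F w \in L.
  move=> wL; have [sw ws w1] := (LP w).1 wL.
  have ps := push_labels_gens (g := 1) ws.
  apply/LP; rewrite (FE _ wL); have := prodL _ wL; case: holonomy => e; split.
  - by rewrite size_flip size_push_labels.
  - exact: flip_gens.
  - by rewrite (prod_flip (has_U ps e)) e zz.
  - by rewrite size_push_labels.
  - by [].
  - by [].
have hF w : w \in L -> holonomy 1 (F w) = holonomy 1 (push_labels 1 w).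
  by move=> wL; rewrite (FE _ wL); case: ifP => // <-; rewrite holonomy_flip.
have Finj : {in L &, injective F}.
  move=> w w' wL wL' ww; have [_ ws _] := (LP w).1 wL; have [_ ws' _] := (LP w').1 wL'.
  apply: (push_labels_inj (g := 1)) => //.
  (* As [F] keeps the holonomy, [F w] itself tells whether a flip was applied, and the flip can be
     undone. *)
  have := ww; rewrite (FE _ wL) (FE _ wL') -(hF _ wL) -(hF _ wL') ww.
  by case: ifP => // _; exact: (inv_inj flipK).
have w0L : w0 \in L.
  by apply/LP; split=> // t /w0T tT; rewrite mem_cat tT orbT.
have uF : uniq [seq F w | w <- L] by rewrite map_inj_in_uniq.
have sF : {subset [seq F w | w <- L] <= L} by move=> _ /mapP[w wL ->]; exact: FL.
(* An injection of a finite set into itself is onto, so [w0] is some [F w]. Its odd holonomy means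
   that a flip was applied; but [flip] fixes the tight word [w0], which would then have product
   [z]. *)
have [_ /(_ w0)] := uniq_min_size uF sF (eq_leq (esym (size_map F L))).
rewrite w0L => /mapP[w wL w0F]; have h1 : holonomy 1 (push_labels 1 w) by rewrite -(hF _ wL) -w0F.
have := FE _ wL; rewrite h1 -w0F => e.
have := prodL _ wL; rewrite h1 -(flipK (push_labels 1 w)) -e => wz.
by have := T_prod w0T; rewrite -{1}(flip_T w0T) wz eqxx.
Qed.

End NotCovered.

Lemma twist_not_LG_rigid (K : realType) :
  (forall D : set G, finite_set D -> exists nu : G -> bool,
    [/\ forall g, nu (g * z) = nu g,
        forall g s, s \in T1 -> nu (g * s) = nu g,
        exists w, [/\ {subset w <= T0 ++ T1}, \prod_(s <- w) s = 1 & holonomy nu 1 w]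
      & forall g0, exists phi : G -> bool,
        [/\ forall g, phi (g * z) = phi g,
            forall g s, s \in T0 -> phi (g * s) = phi g
          & forall g s, D (g0^-1 * g) -> s \in T1 -> phi (g * s) = phi g (+) nu g]]) ->
  ~ LG_rigid K X.
Proof.
move=> H [R [R0 rig]].
pose n := (Num.truncn (R + 1 + 1)).+1.
have Rn : R + 1 + 1 <= n%:R by apply: ltW; exact: truncnS_gt.
pose B := [set g | (word_length twist_gen_set g <= n)%N].
have Bf : finite_set B by exact: word_length_finite.
(* A gauge moves the centre of a ball by a power of [z], so [D] is made stable under [z]. *)
pose D := B `|` [set g * z | g in B].
have Df : finite_set D by rewrite finite_setU; split=> //; exact: finite_image.
have zzK g : g * z * z = g by rewrite -mulgA zz mulg1.
have Dz (b : bool) g : D g -> D (g * z ^+ b).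
  case: b; last by rewrite expg0 mulg1.
  rewrite expg1 => -[Bg|[h Bh <-]]; first by right; exists g.
  by rewrite zzK; left.
have [nu [nuz nuT [w [wT w1 wh]] loc]] := H _ Df.
have [|f [fs fa fb]] := rig (twist_graph nuz nuT).
  move=> y; have [phi [phiz phi0 phi1]] := loc y.
  (* As [gauge phi] is an involution, it sends the centre [gauge phi y] to [y]. *)
  exists (gauge phi y); rewrite -{2}(gaugeK phiz y).
  apply: (gauge_isometric nuz nuT phiz phi0 _ Rn) => g s dg sT; apply: phi1 => //.
  have -> : y^-1 * g = (gauge phi y)^-1 * g * z ^+ phi y.
    by rewrite /gauge invgM zbV -!mulgA zbC -!mulgA zb_mul addbb mulg1.
  apply: Dz; move: dg; rewrite geq_min => /orP[dg|dg]; first by left.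
  by right; exists ((gauge phi y)^-1 * g * z) => //; rewrite zzK.
(* Left translations are automorphisms of the Cayley graph; translating by [x0] makes the covering
   preserve the identity. *)
have [x0 _ fx0] := fs 1 I.
have adjx g h : g^-1 * h \in U ++ T0 ++ T1 ->
    cayley_adj twist_gen_set (x0 * g) (x0 * h).
  by move=> gh; apply/cayley_adjE; rewrite invgM -mulgA mulKg.
apply: (@twist_not_covered nu nuz (fun g => f (x0 * g))) wT w1 wh.
- by rewrite mulg1.
- by move=> g h /adjx/fa.
- move=> g h k /adjx gh /adjx gk e; have [_ inj _] := fb (x0 * g).
  by apply: (@mulgI _ x0); apply: inj e; rewrite inE.
Qed.
End Twist.

(** * Levels in the free group, and the twisting cocycle *)

Section Tally.
Local Notation letter := (letter 'I_2).

Definition level_step (p : int) (x : letter) : int :=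
  if x.1 == ord0 then (if x.2 then p + 1 else p - 1) else p.
Definition word_level : int -> seq letter -> int := foldl level_step.
(* The parity of the number of occurrences of the second generator or of its inverse
   at the levels where [chi] holds, the level being the exponent of the first one. *)
Fixpoint word_tally (chi : int -> bool) (p : int) (w : seq letter) : bool :=
  if w is x :: w' then ((x.1 != ord0) && chi p) (+) word_tally chi (level_step p x) w'
  else false.

Lemma level_stepK p x : level_step (level_step p x) (linv x) = p.
Proof.
by rewrite /level_step /=; case: (x.1 == _); case: (x.2) => /=; rewrite ?addrK ?subrK.
Qed.

Lemma word_level_push p x w : word_level p (push x w) = word_level p (x :: w).
Proof. by case: w => //= y w; case: eqP => // ->; rewrite level_stepK. Qed.

(** A cancelling pair of letters of the second generator is read twice at the same level, which
    leaves the parity unchanged. *)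
Lemma word_tally_push chi p x w : word_tally chi p (push x w) = word_tally chi p (x :: w).
Proof.
case: w => //= y w; case: eqP => // ->; rewrite level_stepK addbA.
suff -> : (x.1 != ord0) && chi p = ((linv x).1 != ord0) && chi (level_step p x).
  by rewrite addbb.
by rewrite /level_step /=; case: eqP.
Qed.

Lemma word_levelM p u v : word_level p (rmul u v) = word_level (word_level p u) v.
Proof. by elim: u p => //= x u IH p; rewrite word_level_push /= IH. Qed.

Lemma word_tallyM chi p u v :
  word_tally chi p (rmul u v) = word_tally chi p u (+) word_tally chi (word_level p u) v.
Proof. by elim: u p => //= x u IH p; rewrite word_tally_push /= IH addbA. Qed.

Lemma word_level_add p w : word_level p w = p + word_level 0 w.
Proof.
elim/last_ind: w => [|w x IH]; first by rewrite addr0.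
rewrite /word_level !foldl_rcons -!/(word_level _ _) IH /level_step.
by case: ifP => // _; case: ifP => // _; rewrite addrA.
Qed.

Lemma word_level_le p w : (`|word_level p w - p| <= size w)%N.
Proof.
elim: w p => [|x w IH] p /=; first by rewrite subrr.
have := IH (level_step p x); rewrite /level_step.
by case: ifP => _; [case: ifP => _|]; lia.
Qed.

(** The level moves by at most one per letter, so the word is too short to get to level [j]. *)
Lemma word_tally_far j p w : (size w < `|j - p|)%N -> word_tally (pred1 j) p w = false.
Proof.
elim: w p => //= x w IH p jp; rewrite IH; last first.
  by move: jp; rewrite /level_step; case: ifP => _; [case: ifP => _|]; lia.
have /negbTE -> : p != j by apply/eqP; lia.
by rewrite andbF.
Qed.

Local Open Scope group_scope.

Definition level (u : F2) : int := word_level 0%R (fg_word u).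
Definition tally chi (p : int) (u : F2) : bool := word_tally chi p (fg_word u).

Lemma levelM u v : level (u * v) = (level u + level v)%R.
Proof. by rewrite /level /= word_levelM word_level_add. Qed.
Lemma tallyM chi p u v : tally chi p (u * v) = tally chi p u (+) tally chi (p + level u)%R v.
Proof. by rewrite /tally /= word_tallyM word_level_add. Qed.

Definition genF (i : 'I_2) : F2 := @FreeGroup _ [:: (i, true)] isT.
Definition genA := genF ord0.
Definition genB := genF ord_max.

Lemma level_genA n : level (genA ^+ n) = n%:Z.
Proof.
elim: n => [|n IH]; first by rewrite expg0.
rewrite expgSr levelM IH.
by rewrite -[in RHS]addn1 PoszD.
Qed.
Lemma tally_genA chi p n : tally chi p (genA ^+ n) = false.
Proof.
by elim: n p => [|n IH] p; rewrite ?expg0// expgS tallyM IH /tally.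
Qed.
Lemma level_genB : level genB = 0%R. Proof. by []. Qed.
Lemma tally_genB chi p : tally chi p genB = chi p.
Proof. by rewrite /tally /= addbF. Qed.
Lemma tally_genBV chi p : tally chi p genB^-1 = chi p.
Proof. by rewrite /tally /= addbF. Qed.

End Tally.

(** * Generators and cocycle from an embedding of [F2 * F2] that avoids a central involution *)

Section Embedding.
Variables (G : groupType) (z : G).
Local Open Scope group_scope.
Hypotheses (zz : z * z = 1) (zC : forall g, z * g = g * z).
Variable iota : F2 * F2 -> G.
Hypotheses (iotaM : forall p q, iota (p * q) = iota p * iota q)
  (iota_inj : forall p, iota p = 1 -> p = 1) (iota_z : forall p, iota p != z).

Lemma iota1 : iota 1 = 1.
Proof. by apply: (@mulgI _ (iota 1)); rewrite -iotaM !mulg1. Qed.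
Lemma iotaV p : iota p^-1 = (iota p)^-1.
Proof. by apply/esym/mulg1_eq; rewrite -iotaM mulgV iota1. Qed.
Lemma iota_injective : injective iota.
Proof.
move=> p q e; apply/divg1_eq/iota_inj.
by rewrite iotaM iotaV e mulgV.
Qed.
Lemma iotazb_inj p q (b c : bool) : iota p * z ^+ b = iota q * z ^+ c -> p = q /\ b = c.
Proof.
have nz (p' q' : F2 * F2) : iota p' * z <> iota q'.
  by move=> e; have /eqP[] := iota_z (p'^-1 * q'); rewrite iotaM iotaV -e mulKg.
case: b c => -[]; rewrite ?expg0 ?expg1 ?mulg1.
- by move=> /mulIg/iota_injective.
- by move=> /nz.
- by move=> /esym/nz.
- by move=> /iota_injective.
Qed.

(** The value is false off the subgroup generated by [z] and the image of [iota]: its other left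
    cosets carry no twist. *)
Definition extend (f : F2 * F2 -> bool) (g : G) : bool :=
  `[< exists p (b : bool), g = iota p * z ^+ b /\ f p >].

Lemma extendE f p (b : bool) : extend f (iota p * z ^+ b) = f p.
Proof.
apply/asboolP/idP => [[q [c [/iotazb_inj[<- _]]]]//|fp].
by exists p, b.
Qed.

Lemma extend_out f g : (forall p (b : bool), g <> iota p * z ^+ b) -> extend f g = false.
Proof. by move=> ng; apply/asboolP => -[p [b [/ng]]]. Qed.

Lemma extendz f g : extend f (g * z) = extend f g.
Proof.
have [[p [b ->]]|ng] := pselect (exists p (b : bool), g = iota p * z ^+ b).
  by rewrite -mulgA -{2}(expg1 z) (zb_mul zz b true) !extendE.
rewrite !extend_out// => p b e; apply: ng.
  by exists p, b.
by exists p, (b (+) true); rewrite -(zb_mul zz b true) mulgA -e expg1 -mulgA zz mulg1.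
Qed.

Lemma extendM f h q g : (forall p, f (p * q) = f p (+) h p) ->
  extend f (g * iota q) = extend f g (+) extend h g.
Proof.
move=> fq; have [[p [b ->]]|ng] := pselect (exists p (b : bool), g = iota p * z ^+ b).
  by rewrite -mulgA (zbC zC) mulgA -iotaM !extendE.
rewrite !extend_out// => p b e; apply: ng; first by exists p, b.
  by exists p, b.
by exists (p * q^-1), b; rewrite iotaM iotaV -mulgA -(zbC zC) mulgA -e mulgK.
Qed.

Let t : F2 * F2 := (genA, genA).
Let b : F2 * F2 := (genB, 1).
Let y : F2 * F2 := (1, genB).
Definition tightP0 : seq (F2 * F2) := [:: t; t^-1; y; y^-1].
Definition tightP1 : seq (F2 * F2) := [:: b; b^-1].
Definition tight0 := map iota tightP0.
Definition tight1 := map iota tightP1.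

(** All products of tight generators satisfy this, so the levels of both coordinates can be
    compared. *)
Definition balanced (p : F2 * F2) : bool := level p.1 == level p.2.
(* The parity of the occurrences of [y] in [p] that fail to commute with a [b]
   appended to [p] in the central extension defined by the cocycle. *)
Definition twistP (k : nat) (p : F2 * F2) : bool :=
  balanced p && tally (pred1 (level p.1 - k%:Z)%R) 0%R p.2.
Definition twistG k : G -> bool := extend (twistP k).

Lemma levelM1 (p q : F2 * F2) : level (p * q).1 = (level p.1 + level q.1)%R.
Proof. exact: levelM. Qed.
Lemma levelM2 (p q : F2 * F2) : level (p * q).2 = (level p.2 + level q.2)%R.
Proof. exact: levelM. Qed.

Lemma balancedMr p q : q \in tightP0 ++ tightP1 -> balanced (p * q) = balanced p.
Proof.
move=> qT; rewrite /balanced levelM1 levelM2.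
have -> : level q.1 = level q.2 by apply/eqP; move: q qT; apply/allP.
by rewrite (inj_eq (addIr _)).
Qed.

Lemma extend0 g : extend (fun _ => false) g = false.
Proof. by apply/asboolP => -[? [? []]]. Qed.

Lemma twistG_tight1 k g s : s \in tight1 -> twistG k (g * s) = twistG k g.
Proof.
case/mapP => q qT ->; rewrite -[RHS]addbF -(extend0 g); apply: extendM => p.
rewrite addbF /twistP balancedMr ?mem_cat ?qT ?orbT//.
have -> : level (p * q).1 = level p.1.
  rewrite levelM1 -[RHS]addr0; congr (_ + _)%R.
  by apply/eqP; move: q qT; apply/allP.
suff -> : (p * q).2 = p.2 by [].
rewrite -[RHS]mulg1; congr (_ * _).
by apply/eqP; move: q qT; apply/allP.
Qed.

(** Supplies a [k] that exceeds all displacements inside [D], for use in [gauge_exists]. *)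
Lemma finite_bound (D : set G) : finite_set D -> exists k : nat,
  forall h1 h2 p (c : bool), D h1 -> D h2 -> h1^-1 * h2 = iota p * z ^+ c ->
    (size (fg_word p.1) + size (fg_word p.2) < k)%N.
Proof.
move=> Df.
pose E := [set (h.1)^-1 * h.2 * z ^+ c | h in D `*` D & c in [set: bool]].
have Ef : finite_set E.
  by apply: finite_image2; [exact: finite_setX|exact: finite_finset].
have /finite_seqP[L LE] : finite_set (iota @^-1` E).
  by apply: finite_preimage Ef => p q _ _; exact: iota_injective.
exists (\max_(p <- L) (size (fg_word p.1) + size (fg_word p.2))).+1.
move=> h1 h2 p c D1 D2 e; rewrite ltnS.
suff pL : p \in L by rewrite (leq_bigmax_seq (F := fun p : F2 * F2 => _) p pL).
suff : (iota @^-1` E) p by rewrite LE.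
exists (h1, h2) => //; exists c => //=.
by rewrite e zbK.
Qed.

(** Inside a translate of [D], second coordinates differ from a fixed [p0.2] by words too short to
    reach the level that [twistP k] inspects. The twist thus depends only on the level of the first
    coordinate, and a tally along that coordinate is a primitive of it. *)
Lemma gauge_exists (D : set G) k (g0 : G) :
  (forall h1 h2 p (c : bool), D h1 -> D h2 -> h1^-1 * h2 = iota p * z ^+ c ->
    (size (fg_word p.1) + size (fg_word p.2) < k)%N) ->
  exists phi : G -> bool,
  [/\ forall g, phi (g * z) = phi g,
      forall g s, s \in tight0 -> phi (g * s) = phi g
    & forall g s, D (g0^-1 * g) -> s \in tight1 ->
        phi (g * s) = phi g (+) twistG k g].
Proof.
move=> Dk.
have [[p0 [c0 [Dp0 bp0]]]|nD] := pselect (exists p (c : bool),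
    D (g0^-1 * (iota p * z ^+ c)) /\ balanced p); last first.
  (* The translate has no balanced element, so the twist vanishes on it. *)
  exists (fun _ => false); split=> // g s Dg sT; suff -> : twistG k g = false by [].
  by apply/asboolP => -[p [c [gp /andP[bp _]]]]; apply: nD; exists p, c; rewrite -gp.
(* The value of the twist at level [j] of the first coordinate, with the second one frozen at
   [p0.2]. *)
pose chi (j : int) := tally (pred1 (j - k%:Z)%R) 0%R p0.2.
pose f (p : F2 * F2) := balanced p && tally chi 0%R p.1.
exists (extend f); split; first exact: extendz.
- move=> g s /mapP[q qT ->]; rewrite -[RHS]addbF -(extend0 g); apply: extendM => p.
  rewrite addbF /f balancedMr ?mem_cat ?qT//; congr (_ && _).
  rewrite tallyM; suff -> : forall c i, tally c i q.1 = false by rewrite addbF.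
  by move=> c i; move: qT; rewrite !inE => /or4P[]/eqP ->; rewrite /tally.
move=> g s Dg /mapP[q qT ->].
have qt p : f (p * q) = f p (+) (balanced p && chi (level p.1)).
  rewrite /f balancedMr ?mem_cat ?qT ?orbT// -andb_addr; congr (_ && _).
  rewrite tallyM add0r; congr (_ (+) _).
  by move: qT; rewrite !inE => /orP[]/eqP ->; rewrite ?tally_genB ?tally_genBV.
rewrite (extendM (h := fun p => balanced p && chi (level p.1)) _ qt); congr (_ (+) _).
have [[p [c gp]]|ng] := pselect (exists p (c : bool), g = iota p * z ^+ c); last first.
  by rewrite /twistG !extend_out// => p c e; apply: ng; exists p, c.
rewrite gp /twistG !extendE /twistP; have [bp|//] := boolP (balanced p); rewrite !andTb.
set r := p0^-1 * p.
have -> : p.2 = p0.2 * r.2 by have := mulVKg p0 p => /(congr1 snd).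
rewrite /chi tallyM add0r -[LHS]addbF; congr (_ (+) _).
have sr : (size (fg_word r.1) + size (fg_word r.2) < k)%N.
  apply: (Dk _ _ r (c0 (+) c) Dp0 Dg); rewrite gp invgM invgK -mulgA mulVKg.
  rewrite invgM (zbV zz) -(zb_mul zz) iotaM iotaV (zbC zC c0 (iota p0)^-1) -!mulgA; congr (_ * _).
  by rewrite !mulgA (zbC zC).
have lp : level p.1 = (level p0.1 + level r.1)%R by rewrite -levelM1 /r mulVKg.
(* The word [r.2] is read from [level p0.2], which is [level p0.1]. The inspected level is at least
   [k] minus the size of [r.1] away, more than the size of [r.2]. *)
apply/esym; rewrite /tally; apply: word_tally_far; move/eqP: bp0 => <-; rewrite lp.
have := word_level_le 0 (fg_word r.1); rewrite -/(level _).
set m := size (fg_word r.2) in sr *; set m1 := size (fg_word r.1) in sr *.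
set l0 := level p0.1; set l := level r.1; clearbody m m1 l0 l; move: sr; lia.
Qed.

Variable gen : seq G.
Hypothesis gen_ind : forall H : G -> Prop, H 1 -> (forall g h, H g -> H h -> H (g * h)) ->
  (forall g, H g -> H g^-1) -> (forall g, g \in gen -> H g) -> forall g, H g.

Let T := tight0 ++ tight1.
(** The element [iota (genA, 1)] ensures that there is a loose generator: it is not tight, even up
    to [z]. *)
Let half := gen ++ [seq g^-1 | g <- gen] ++ [:: iota (genA, 1); iota (genA, 1)^-1].
(** Discarding the tight elements and their products with [z] keeps tight edges from being doubled;
    discarding 1 and [z] avoids loops and preserves stability under [z]. *)
Definition loose : seq G :=
  [seq u <- half ++ [seq g * z | g <- half] |
    [&& u \notin T, u * z \notin T, u != 1 & u != z]].

Lemma loose_keep g : (g \in half) || (g * z \in half) ->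
  [&& g \notin T, g * z \notin T, g != 1 & g != z] -> g \in loose.
Proof.
move=> gh gT; rewrite mem_filter gT mem_cat; case/orP: gh => [->//|gzh].
by apply/orP; right; apply/mapP; exists (g * z) => //; rewrite -mulgA zz mulg1.
Qed.

Lemma looseP g : g \in loose -> [/\ g \notin T, g * z \notin T, g != 1, g != z &
  (g \in half) || (g * z \in half)].
Proof.
rewrite mem_filter => /andP[/and4P[-> -> -> ->]]; rewrite mem_cat.
case/orP=> [->//|/mapP[h hh ->]]; split=> //.
by rewrite -mulgA zz mulg1 hh orbT.
Qed.

Lemma T_iota s : s \in T -> exists2 p, p \in tightP0 ++ tightP1 & s = iota p.
Proof. by rewrite /T -map_cat => /mapP. Qed.

Lemma TV s : s \in T -> s^-1 \in T.
Proof.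
move=> /T_iota[p pT ->]; rewrite -iotaV /T -map_cat (mem_map iota_injective).
by move: p pT; apply/allP.
Qed.

Lemma half_sym g : g \in half -> g^-1 \in half.
Proof.
rewrite !mem_cat => /or3P[gS|/mapP[h hS ->]|].
- by rewrite (map_f _ gS) orbT.
- by rewrite invgK hS.
- by rewrite !inE => /orP[]/eqP ->; rewrite -iotaV ?invgK eqxx ?orbT.
Qed.

Lemma zV : z^-1 = z.
Proof. exact: mulg1_eq. Qed.

Lemma invMz g : (g * z)^-1 = g^-1 * z.
Proof. by rewrite invgM zV zC. Qed.

Lemma TVE g : (g^-1 \in T) = (g \in T).
Proof. by apply/idP/idP => [/TV|/TV//]; rewrite invgK. Qed.

Lemma loose_sym g : g \in loose -> g^-1 \in loose.
Proof.
case/looseP=> gT gzT g1 gz gh; apply: loose_keep; last first.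
  by rewrite -invMz !TVE gT gzT invg_eq1 g1 -zV (inj_eq invg_inj).
by rewrite -invMz; case/orP: gh => /half_sym ->; rewrite ?orbT.
Qed.

Lemma loosez g : g \in loose -> g * z \in loose.
Proof.
have zzK h : h * z * z = h by rewrite -mulgA zz mulg1.
case/looseP=> gT gzT g1 gz gh; apply: loose_keep; first by rewrite zzK orbC.
rewrite zzK gT gzT mulg_eq1 zV gz /= -{2}(mul1g z) (inj_eq (@mulIg _ z)).
exact: g1.
Qed.

Lemma iota_T p : (iota p \in T) = (p \in tightP0 ++ tightP1).
Proof. by rewrite /T -map_cat (mem_map iota_injective). Qed.

Lemma iotaz_T p : iota p * z \notin T.
Proof.
apply/negP => /T_iota[q _]; rewrite -[RHS]mulg1 -{1}(expg1 z) -(expg0 z).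
by move=> /(@iotazb_inj p q true false)[].
Qed.

Lemma base_loose : iota (genA, 1) \in loose.
Proof.
apply: loose_keep; first by rewrite /half !mem_cat mem_head !orbT.
rewrite iota_T iotaz_T iota_z andbT -iota1 (inj_eq iota_injective).
by [].
Qed.

(** A quotient of two loose elements is [z]; each element of [gen] that is not loose is tight or
    trivial up to a factor [z]. *)
Lemma loose_gen g : exists n, product_of_length [set s | s \in loose ++ tight0 ++ tight1] n g.
Proof.
set S := (S in product_of_length S); pose H g := exists n, product_of_length S n g.
have HM g1 g2 : H g1 -> H g2 -> H (g1 * g2).
  move=> [n1 [w1 [s1 S1 ->]]] [n2 [w2 [s2 S2 ->]]]; exists (n1 + n2)%N, (w1 ++ w2).
  split; [by rewrite size_cat s1 s2|move=> s|by rewrite big_cat].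
  by rewrite mem_cat => /orP[/S1|/S2].
have HS s : s \in loose ++ T -> H s.
  move=> sS; exists 1%N, [:: s]; split=> // [v|]; last by rewrite big_seq1.
  by rewrite inE => /eqP ->.
have H1 : H 1 by exists 0%N, [::]; rewrite big_nil.
have SV s : S s -> S s^-1.
  rewrite /S /= !(mem_cat _ loose) => /orP[/loose_sym ->//|/TV].
  by rewrite /T => ->; rewrite orbT.
have HV g1 : H g1 -> H g1^-1.
  move=> [n [w [_ Sw ->]]]; elim: w Sw => [|s w IH] Sw; first by rewrite big_nil invg1.
  rewrite big_cons invgM; apply: HM.
    by apply: IH => v vw; apply: Sw; rewrite inE vw orbT.
  by apply/HS/SV/Sw; rewrite inE eqxx.
have Hz : H z.
  have -> : z = (iota (genA, 1))^-1 * (iota (genA, 1) * z) by rewrite mulKg.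
  by apply: HM; apply: HS; rewrite mem_cat ?(loose_sym base_loose) ?(loosez base_loose).
apply: (gen_ind (H := H)) => // {}g gS.
have [gT|gT] := boolP (g \in T); first by apply: HS; rewrite mem_cat gT orbT.
have [gzT|gzT] := boolP (g * z \in T).
  have -> : g = g * z * z by rewrite -mulgA zz mulg1.
  by apply: HM => //; apply: HS; rewrite mem_cat gzT orbT.
have [->//|g1] := eqVneq g 1; have [->//|gz] := eqVneq g z.
apply: HS; rewrite mem_cat loose_keep//; first by rewrite !mem_cat gS.
by rewrite gT gzT g1 gz.
Qed.

Lemma holonomy_cat nu g (w1 w2 : seq G) : holonomy tight1 nu g (w1 ++ w2) =
  holonomy tight1 nu g w1 (+) holonomy tight1 nu (g * \prod_(s <- w1) s) w2.
Proof.
elim: w1 g => [|s w IH] g /=; first by rewrite big_nil mulg1.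
by rewrite IH big_cons mulgA addbA.
Qed.

Lemma tight10 s : s \in tight1 -> s \notin tight0.
Proof.
case/mapP => p pT ->; rewrite (mem_map iota_injective).
by move: p pT; apply/allP.
Qed.

Lemma holonomy_tight0 nu g w : {subset w <= tight0} -> holonomy tight1 nu g w = false.
Proof.
elim: w g => //= s w IH g ws; rewrite IH => [|u uw]; last by apply: ws; rewrite inE uw orbT.
suff -> : (s \in tight1) = false by rewrite andbF.
by apply/negP => /tight10; rewrite ws// inE eqxx.
Qed.

Lemma prod_nseq p n : \prod_(s <- nseq n (iota p)) s = iota (p ^+ n).
Proof.
elim: n => [|n IH] /=; first by rewrite big_nil expg0 iota1.
by rewrite big_cons IH expgS iotaM.
Qed.

(* The commutator of [y] and of the conjugate of [b] by [t ^+ k]. *)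
Lemma holonomy_witness k : exists w,
  [/\ {subset w <= tight0 ++ tight1}, \prod_(s <- w) s = 1 & holonomy tight1 (twistG k) 1 w].
Proof.
pose tk := nseq k (iota t); pose tk' := nseq k (iota t^-1).
have ptk : \prod_(s <- tk) s = iota (t ^+ k) by exact: prod_nseq.
have ptk' : \prod_(s <- tk') s = iota (t ^- k) by rewrite prod_nseq expVgn.
pose w1 := iota y :: tk; pose w2 := tk' ++ iota y^-1 :: tk.
have pw1 : \prod_(s <- w1) s = iota (y * t ^+ k) by rewrite big_cons ptk iotaM.
have pw2 : \prod_(s <- w2) s = iota (t ^- k * (y^-1 * t ^+ k)).
  by rewrite big_cat big_cons ptk /= ptk' !iotaM.
have t0 p : p \in tightP0 -> iota p \in tight0 by exact: map_f.
have tk0 : {subset tk <= tight0} by move=> s /nseqP[-> _]; exact: t0.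
have tk'0 : {subset tk' <= tight0} by move=> s /nseqP[-> _]; exact: t0.
have w10 : {subset w1 <= tight0}.
  by move=> s; rewrite inE => /predU1P[->|/tk0//]; exact: t0.
have w20 : {subset w2 <= tight0}.
  by move=> s; rewrite mem_cat inE => /or3P[/tk'0//|/eqP ->|/tk0//]; exact: t0.
have b1 : iota b \in tight1 by exact: map_f.
have b1' : iota b^-1 \in tight1 by exact: map_f.
have tk1 : (t ^+ k).1 = genA ^+ k by elim: (k) => // n IH; rewrite !expgS -IH.
have tk2 : (t ^+ k).2 = genA ^+ k by elim: (k) => // n IH; rewrite !expgS -IH.
exists (w1 ++ [:: iota b] ++ w2 ++ [:: iota b^-1] ++ tk'); split.
- have sub0 v : {subset v <= tight0} -> all (mem (tight0 ++ tight1)) v.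
    move=> v0; apply/allP => s /v0 s0.
    by have : s \in tight0 ++ tight1 by rewrite mem_cat s0.
  have sub1 s : s \in tight1 -> s \in tight0 ++ tight1.
    by move=> s1; rewrite mem_cat s1 orbT.
  apply/allP; rewrite all_cat (sub0 _ w10) /= sub1//= all_cat (sub0 _ w20) /=.
  by rewrite sub1//= sub0.
- rewrite big_cat pw1 big_cat big_seq1 big_cat pw2 big_cat big_seq1 ptk' /= -!iotaM.
  suff -> : y * t ^+ k * (b * (t ^- k * (y^-1 * t ^+ k) * (b^-1 * t ^- k))) = 1.
    exact: iota1.
  rewrite [LHS]surjective_pairing /= tk1 tk2 !(mul1g, mulg1, invg1).
  by rewrite !mulgA !(mulgK, mulgVK, mulgV).
have hol1 g s : s \in tight1 -> holonomy tight1 (twistG k) g [:: s] = twistG k g.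
  by move=> s1; rewrite /= s1 andbT addbF.
have twE p : twistG k (iota p) = twistP k p.
  by have := extendE (twistP k) p false; rewrite expg0 mulg1.
(* Only [b] and [b^-1] can contribute. Before [b] the second coordinate has its letter [genB] at
   level 0, which is the level inspected; before [b^-1] that letter has been cancelled. *)
rewrite holonomy_cat holonomy_tight0// pw1 mul1g holonomy_cat hol1// big_seq1.
rewrite holonomy_cat holonomy_tight0// pw2 holonomy_cat hol1// holonomy_tight0//.
rewrite addbF !addFb -!iotaM !twE /twistP.
have -> : (y * t ^+ k * b * (t ^- k * (y^-1 * t ^+ k))) = (genA ^+ k * genB, genA ^+ k).
  rewrite [LHS]surjective_pairing /= tk1 tk2 !(mul1g, mulg1, invg1).
  by rewrite !mulgA !(mulgK, mulgVK, mulgV, mul1g).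
have -> : y * t ^+ k = (genA ^+ k, genB * genA ^+ k).
  by rewrite [LHS]surjective_pairing /= tk1 tk2 !(mul1g, mulg1).
rewrite /balanced /= !levelM !tallyM !tally_genA tally_genB level_genB add0r addr0 eqxx.
by rewrite level_genA subrr.
Qed.

Theorem embedding_not_LG_rigid (K : realType) :
  exists S : gen_set G, ~ LG_rigid K (cayley S).
Proof.
have T1_T g : g \in tight1 -> g \in T by move=> gT; rewrite /T mem_cat gT orbT.
have T0_T g : g \in tight0 -> g \in T by move=> gT; rewrite /T mem_cat gT.
have nz1 : 1 \notin T by rewrite -iota1 iota_T.
have nzz : z \notin T by rewrite -[z]mul1g -iota1 iotaz_T.
have TV0 g : g \in tight0 -> g^-1 \in tight0.
  by case/mapP => p pT ->; rewrite -iotaV (mem_map iota_injective); move: p pT; apply/allP.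
have TV1 g : g \in tight1 -> g^-1 \in tight1.
  by case/mapP => p pT ->; rewrite -iotaV (mem_map iota_injective); move: p pT; apply/allP.
have T_loose g : g \in T -> g \notin loose.
  by move=> gT; apply/negP => /looseP[]; rewrite gT.
exists (twist_gen_set TV0 TV1 loose_sym loose_gen).
apply: (twist_not_LG_rigid zz zC loosez _ _ _ _ _ _ _ _ _ base_loose).
- by apply: contraNN nz1; exact: T0_T.
- by apply: contraNN nz1; exact: T1_T.
- by apply: contraNN nzz; exact: T1_T.
- by apply/negP => /looseP[_ _]; rewrite eqxx.
- by move=> g /T1_T/T_loose.
- by move=> g /T0_T/T_loose.
- exact: tight10.
- by move=> _ /mapP[p _ ->]; apply: contraNN (iotaz_T p); exact: T0_T.
- move=> w wT; suff [p ->] : exists p, \prod_(s <- w) s = iota p by exact: iota_z.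
  elim: w wT => [|s w IH] wT; first by exists 1; rewrite big_nil iota1.
  have [|p wp] := IH; first by move=> r rw; apply: wT; rewrite inE rw orbT.
  have /T_iota[q _ ->] := wT s (mem_head _ _).
  by exists (q * p); rewrite big_cons wp iotaM.
move=> D Df; have [k Dk] := finite_bound Df; exists (twistG k); split.
- exact: extendz.
- by move=> g s; exact: twistG_tight1.
- exact: holonomy_witness.
- by move=> g0; exact: gauge_exists Dk.
Qed.

End Embedding.

(** * The two examples *)

Section FreeInd.
Local Open Scope group_scope.

Lemma F2_ind (H : F2 -> Prop) : H 1 -> (forall u v, H u -> H v -> H (u * v)) ->
  (forall u, H u -> H u^-1) -> H genA -> H genB -> forall u, H u.
Proof.
move=> H1 HM HV HA HB [w rw].
have Hx (x : letter 'I_2) (rx : reduced [:: x]) : H (FreeGroup rx).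
  have HG i : H (genF i).
    case: i => -[|[|//]] lti; [move: HA|move: HB]; rewrite /genA /genB;
      by congr (H (genF _)); exact: val_inj.
  case: x rx => i [] rx; first by rewrite (_ : FreeGroup rx = genF i) //; exact: val_inj.
  by rewrite (_ : FreeGroup rx = (genF i)^-1); [exact: HV|exact: val_inj].
elim: w rw => [|x w IH] rw; first by rewrite (_ : FreeGroup rw = 1)//; exact: val_inj.
have rw' : reduced w by exact: path_sorted rw.
rewrite (_ : FreeGroup rw = FreeGroup (isT : reduced [:: x]) * FreeGroup rw').
  exact: HM.
apply: val_inj => /=; case: w rw {IH rw'} => //= y w /andP[/negbTE ->] //.
Qed.

End FreeInd.

(** * The example of the product with a cyclic group of order 2 *)

Section ProductExample.
Local Open Scope group_scope.
Variable K : realType.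

Let z : F2xF2xZ2 := (1, inZp 1).
Let iota (p : F2 * F2) : F2xF2xZ2 := (p, 1).

Lemma F2xF2xZ2_not_LG_rigid : exists S : gen_set F2xF2xZ2, ~ LG_rigid K (cayley S).
Proof.
apply: (@embedding_not_LG_rigid F2xF2xZ2 z _ _ iota _ _ _
  [:: iota (genA, 1); iota (genB, 1); iota (1, genA); iota (1, genB); z]).
- by congr pair; [exact: mulg1 | exact: val_inj].
- move=> [p c]; congr pair; first by rewrite /= mul1g mulg1.
  exact: (@Zp_addC 2).
- by move=> p q; congr pair; exact: val_inj.
- by move=> p [].
- by move=> p; apply/eqP => -[].
move=> H H1 HM HV Hg [[u v] c].
have Hz : H z by apply: Hg; rewrite !inE eqxx !orbT.
have Hu w : H (iota (w, 1)).
  elim/F2_ind: w => //.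
  - move=> w w' Hw Hw'; rewrite (_ : iota _ = iota (w, 1) * iota (w', 1)).
      exact: HM.
    by congr (_, _, _); exact: val_inj.
  - move=> w Hw; rewrite (_ : iota _ = (iota (w, 1))^-1); first exact: HV.
    by congr (_, _, _); exact: val_inj.
  - by apply: Hg; rewrite !inE eqxx.
  - by apply: Hg; rewrite !inE eqxx !orbT.
have Hv w : H (iota (1, w)).
  elim/F2_ind: w => //.
  - move=> w w' Hw Hw'; rewrite (_ : iota _ = iota (1, w) * iota (1, w')).
      exact: HM.
    by congr (_, _, _); exact: val_inj.
  - move=> w Hw; rewrite (_ : iota _ = (iota (1, w))^-1); first exact: HV.
    by congr (_, _, _); exact: val_inj.
  - by apply: Hg; rewrite !inE eqxx !orbT.
  - by apply: Hg; rewrite !inE eqxx !orbT.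
have Hc : H (1, c).
  case: c => -[|[|//]] lt2.
    by rewrite (_ : Ordinal lt2 = 1)//; exact: val_inj.
  by rewrite (_ : Ordinal lt2 = inZp 1)//; exact: val_inj.
rewrite (_ : (u, v, c) = iota (u, 1) * iota (1, v) * (1, c)).
  exact: (HM _ _ (HM _ _ (Hu u) (Hv v)) Hc).
by congr (_, _, _); rewrite /= ?mulg1 ?mul1g ?mulg1.
Qed.
End ProductExample.

(** * Generation of the integral special linear groups by elementary matrices *)

Section Elementary.

Definition elem n (i j : 'I_n) (c : int) : 'M[int]_n := 1%:M + c *: delta_mx i j.

Lemma elem_mulE n m (i j : 'I_n) c (A : 'M[int]_(n, m)) k l :
  (elem i j c *m A) k l = A k l + (k == i)%:R * c * A j l.
Proof.
rewrite mulmxDl mul1mx -scalemxAl !mxE; congr (_ + _).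
rewrite (bigD1 j)//= big1 => [|h hj]; first by rewrite !mxE eqxx andbT addr0; ring.
by rewrite !mxE (negbTE hj) andbF mul0r.
Qed.

Lemma elemD n (i j : 'I_n) c d : i != j -> elem i j c *m elem i j d = elem i j (c + d).
Proof.
move=> ij; apply/matrixP => k l; rewrite elem_mulE !mxE (eq_sym j i) (negbTE ij) andFb.
by rewrite mulr0 addr0 [j == l]eq_sym -mulnb natrM; ring.
Qed.

Lemma elem0 n (i j : 'I_n) : elem i j 0 = 1%:M.
Proof. by rewrite /elem scale0r addr0. Qed.

Lemma det_elem n (i j : 'I_n) c : i != j -> \det (elem i j c) = 1.
Proof.
wlog ji : i j / (j < i)%N => [hw|].
  case: (ltngtP j i) => [ji|ij|/val_inj ->]; last by rewrite eqxx.
    exact: hw.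
  move=> neq; rewrite -det_tr (_ : _^T = elem j i c) ?hw// 1?eq_sym//.
  by rewrite /elem raddfD /= tr_scalar_mx linearZ /= trmx_delta.
move=> ij; rewrite det_trig; last first.
  apply/is_trig_mxP => k l kl; rewrite !mxE.
  rewrite -val_eqE (ltn_eqF kl) add0r; case: eqP => [ki|]; rewrite ?mulr0//.
  by case: eqP => [lj|]; rewrite ?mulr0//; move: kl ji; rewrite ki lj; lia.
apply: big1 => k _; rewrite !mxE eqxx; case: eqP => [->|]; rewrite ?mulr0 ?addr0//.
by rewrite (negbTE ij) mulr0 addr0.
Qed.

Lemma elem_rshift m n (i j : 'I_n) c :
  elem (rshift m i) (rshift m j) c = block_mx 1%:M 0 0 (elem i j c).
Proof.
rewrite /elem scalar_mx_block delta_mx_dshift delta_mx_rshift -row_mx0.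
by rewrite -/(block_mx _ _ _ _) scale_block_mx add_block_mx !scaler0 !addr0.
Qed.

Lemma elem_lrshift m n (i : 'I_m) (j : 'I_n) c :
  elem (lshift n i) (rshift m j) c = block_mx 1%:M (c *: delta_mx i j) 0 1%:M.
Proof.
rewrite /elem scalar_mx_block delta_mx_ushift delta_mx_rshift -row_mx0.
by rewrite -/(block_mx _ _ _ _) scale_block_mx add_block_mx !scaler0 !addr0 add0r.
Qed.

(** Row operations run Euclid's algorithm on the first column until it is a unit vector; the rest is
    a block and a row of elementary factors. The induction hypothesis quantifies over predicates
    because it is applied to one about the lower right block. *)
Lemma elem_gen_step n (H : 'M[int]_n.+2 -> Prop) : H 1%:M ->
  (forall A B, H A -> H B -> H (A *m B)) -> (forall i j c, i != j -> H (elem i j c)) ->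
  (forall H' : 'M[int]_n.+1 -> Prop, H' 1%:M ->
    (forall A B, H' A -> H' B -> H' (A *m B)) ->
    (forall i j c, i != j -> H' (elem i j c)) -> forall A, \det A = 1 -> H' A) ->
  forall A, \det A = 1 -> H A.
Proof.
move=> H1 HM HE IH.
have Hrow i j c A : i != j -> H (elem i j c *m A) -> H A.
  move=> ij HA; rewrite -[A]mul1mx -(elem0 i j) -(addNr c) -elemD// -mulmxA.
  by apply: HM => //; exact: HE.
have drow i j c (A : 'M[int]_n.+2) : i != j -> \det A = 1 -> \det (elem i j c *m A) = 1.
  by move=> ij dA; rewrite det_mulmx det_elem// dA mulr1.
have L1 A : \det A = 1 -> A 0 0 = 1 -> (forall k, k != 0 -> A k 0 = 0) -> H A.
  move: A; rewrite -[n.+2]/(1 + n.+1)%N => A dA A00 Ak.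
  have ul : ulsubmx A = 1%:M.
    apply/matrixP => i j; rewrite !mxE !ord1 -[RHS]A00.
    by congr (A _ _); exact: val_inj.
  have dl : dlsubmx A = 0.
    apply/matrixP => i j; rewrite !mxE ord1 -[RHS](Ak (rshift 1 i))//.
    by congr (A _ _); exact: val_inj.
  move: dA; rewrite -[A]submxK ul dl det_ublock det1 mul1r.
  move: (ursubmx A) (drsubmx A) => r B dB.
  have -> : block_mx 1%:M r 0 B = block_mx 1%:M 0 0 B *m block_mx 1%:M r 0 1%:M.
    by rewrite mulmx_block !mul0mx !mul1mx !mulmx0 mulmx1 !addr0 add0r.
  apply: (HM _ _ _).
    pose P (B : 'M[int]_n.+1) := H (block_mx (1%:M : 'M_1) 0 0 B).
    apply: (IH P _ _ _ B dB); rewrite /P.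
    - by rewrite -scalar_mx_block.
    - move=> B1 B2 HB1 HB2.
      have -> : block_mx (1%:M : 'M_1) 0 0 (B1 *m B2) =
                block_mx 1%:M 0 0 B1 *m block_mx 1%:M 0 0 B2.
        by rewrite mulmx_block !mul0mx !mulmx0 mulmx1 !addr0 add0r.
      exact: (HM _ _ HB1 HB2).
    - move=> i j c ij; rewrite -(elem_rshift 1).
      by apply: (HE _ _ _); rewrite (inj_eq (@rshift_inj 1 n.+1)).
  rewrite [r]row_sum_delta.
  pose P (v : 'rV[int]_n.+1) := H (block_mx (1%:M : 'M_1) v 0 1%:M).
  apply: (big_ind P); rewrite /P.
  - by rewrite -scalar_mx_block.
  - move=> r1 r2 Hr1 Hr2.
    have -> : block_mx (1%:M : 'M_1) (r1 + r2) 0 (1%:M : 'M_n.+1) =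
              block_mx 1%:M r1 0 1%:M *m block_mx 1%:M r2 0 1%:M.
      by rewrite mulmx_block !mul0mx !mul1mx !mulmx0 !mulmx1 !addr0 add0r addrC.
    exact: (HM _ _ Hr1 Hr2).
  - by move=> j _; rewrite -elem_lrshift; exact: HE.
have unit (A : 'M[int]_n.+2) i : \det A = 1 -> (forall k, k != i -> A k 0 = 0) -> A i 0 * A i 0 = 1.
  move=> dA Ak; move: dA; rewrite (expand_det_col A 0) (bigD1 i)//= big1 => [|k ki].
    rewrite addr0 => /(congr1 (fun x => `|x|%N)); rewrite abszM => /eqP.
    by rewrite muln_eq1 => /andP[/eqP a1 _]; nia.
  by rewrite Ak// mul0r.
have L2 (A : 'M[int]_n.+2) i : i != 0 -> \det A = 1 -> (forall k, k != i -> A k 0 = 0) -> H A.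
  move=> i0 dA Ak; have u := unit _ _ dA Ak.
  have oi : 0 != i by rewrite eq_sym.
  (* The entry [A i 0] is its own inverse: adding that multiple of row [i] puts 1 at the top, with
     which row [i] is cleared. *)
  apply: (Hrow 0 i (A i 0)) => //; apply: (Hrow i 0 (- A i 0)) => //.
  apply: L1; first by apply: (drow _ _ _ _ _ (drow _ _ _ _ _ dA)).
    rewrite !elem_mulE eqxx (negbTE oi) (Ak 0)//= !mul0r add0r addr0 mul1r; exact: u.
  move=> k k0; rewrite !elem_mulE (negbTE k0) eqxx (Ak 0)//=.
  have [->|ki] := eqVneq k i; rewrite /= ?mul1r !mul0r ?u ?add0r ?addr0.
    by rewrite mulr1 subrr.
  exact: Ak.
have L3 (A : 'M[int]_n.+2) i : \det A = 1 -> (forall k, k != i -> A k 0 = 0) -> H A.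
  have [->|i0] := eqVneq i 0; last exact: L2.
  move=> dA Ak; have u := unit _ _ dA Ak.
  have [a1|a1] : A 0 0 = 1 \/ A 0 0 = -1 by nia.
    exact: L1.
  (* The entry -1 at the top is moved to row [j], where [L2] applies. *)
  pose j : 'I_n.+2 := lift 0 0; have j0 : j != 0 by [].
  have oj : 0 != j by [].
  apply: (Hrow j 0 (-1)) => //; apply: (Hrow 0 j 1) => //.
  apply: (L2 _ j) => //; first by apply: (drow _ _ _ _ _ (drow _ _ _ _ _ dA)).
  move=> k kj; rewrite !elem_mulE eqxx (negbTE kj) (Ak j j0) a1.
  by have [->|k0] := eqVneq k 0; rewrite ?a1 ?(Ak _ k0).
move=> A; have [m] := ubnP (\sum_i `|A i 0%R|)%N.
elim: m A => // m IHm A; rewrite ltnS => Am dA.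
have [[i [j [ij Ai Aj]]]|none] := pselect (exists i j, [/\ i != j, A i 0 != 0 & A j 0 != 0]).
  wlog le : i j ij Ai Aj / (`|A i 0%R| <= `|A j 0%R|)%N.
    move=> hw; case: (leqP `|A i 0%R| `|A j 0%R|)%N => [|/ltnW]; first exact: hw.
    by apply: hw => //; rewrite eq_sym.
  have ji : j != i by rewrite eq_sym.
  (* With this sign, the larger entry loses the absolute value of the smaller one. *)
  pose c : int := - (Num.sg (A i 0) * Num.sg (A j 0)).
  apply: (Hrow j i c) => //; apply: IHm; last exact: (drow _ _ _ _ _ dA).
  apply: leq_trans Am; rewrite (bigD1 j)//= [ltnRHS](bigD1 j)//=.
  have -> : (\sum_(k < n.+2 | k != j) `|(elem j i c *m A)%R k 0%R| =
             \sum_(k < n.+2 | k != j) `|A k 0%R|)%N.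
    by apply: eq_bigr => k kj; rewrite elem_mulE (negbTE kj) !mul0r addr0.
  rewrite ltn_add2r elem_mulE eqxx mul1r /c.
  move: (A i 0) (A j 0) Ai Aj le => a b a0 b0 le.
  by case: (sgrP a) a0 le => //; case: (sgrP b) b0 => //; lia.
have [i Ai|all0] := pickP (fun i => A i 0 != 0).
  apply: (L3 A i) => // k ki; apply/eqP; apply: contraT => Ak.
  by exfalso; apply: none; exists k, i.
by apply: (L3 A 0) => // k _; apply/eqP; have /negbFE := all0 k.
Qed.

Lemma elem_gen n (H : 'M[int]_n -> Prop) : H 1%:M ->
  (forall A B, H A -> H B -> H (A *m B)) -> (forall i j c, i != j -> H (elem i j c)) ->
  forall A, \det A = 1 -> H A.
Proof.
elim: n H => [|[|n] IH] H H1 HM HE A dA.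
- by rewrite (_ : A = 1%:M)// flatmx0 [RHS]flatmx0.
- by rewrite (_ : A = 1%:M)// [A]mx11_scalar -det_mx11 dA.
- exact: elem_gen_step dA.
Qed.

End Elementary.

Section Evaluation.
Local Open Scope group_scope.
Variables (G : groupType) (m : letter 'I_2 -> G).
Hypothesis mV : forall x, m (linv x) = (m x)^-1.

Definition eval_word (w : seq (letter 'I_2)) : G := \prod_(x <- w) m x.

Lemma eval_push x w : eval_word (push x w) = m x * eval_word w.
Proof.
rewrite /eval_word; case: w => [|y w] /=; first by rewrite big_seq1 big_nil mulg1.
by case: eqP => [->|_]; rewrite !big_cons// mV mulVKg.
Qed.

Lemma eval_mul (u v : F2) :
  eval_word (fg_word (u * v)) = eval_word (fg_word u) * eval_word (fg_word v).
Proof.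
rewrite /=; elim: (fg_word u) => [|x w IH] /=; first by rewrite /eval_word big_nil mul1g.
by rewrite eval_push IH /eval_word big_cons mulgA.
Qed.

End Evaluation.

(** * Ping-pong for a free group of 2 by 2 matrices *)

Section PingPong.

(** For [i = j] the determinant is [1 + c], so this is the identity for every [c], by the default
    value if [c] is nonzero. *)
Definition sl_elem n (i j : 'I_n) (c : int) : SLZ n := insubd (1%g : SLZ n) (elem i j c).

Lemma val_sl_elem n (i j : 'I_n) c : i != j -> val (sl_elem i j c) = elem i j c.
Proof. by move=> ij; rewrite val_insubd det_elem// eqxx. Qed.

Lemma sl_elemD n (i j : 'I_n) c d : i != j ->
  (sl_elem i j c * sl_elem i j d)%g = sl_elem i j (c + d).
Proof. by move=> ij; apply: val_inj; rewrite /= !val_sl_elem// elemD. Qed.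

Lemma sl_elem0 n (i j : 'I_n) : i != j -> sl_elem i j 0 = 1%g.
Proof. by move=> ij; apply: val_inj; rewrite /= val_sl_elem// elem0. Qed.

Lemma sl_elemV n (i j : 'I_n) c : i != j -> ((sl_elem i j c)^-1)%g = sl_elem i j (- c).
Proof. by move=> ij; apply: mulg1_eq; rewrite sl_elemD// subrr sl_elem0. Qed.

Lemma SLZ_ind n (H : SLZ n -> Prop) : H 1%g ->
  (forall g h, H g -> H h -> H (g * h)%g) -> (forall g, H g -> H g^-1%g) ->
  (forall i j, H (sl_elem i j 1)) -> forall g, H g.
Proof.
move=> H1 HM HV HE g.
have HN i j k : i != j -> H (sl_elem i j k%:Z).
  move=> ij; elim: k => [|k IH]; first by rewrite sl_elem0.
  by rewrite -addn1 PoszD -sl_elemD//; exact: HM.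
have Hz i j c : i != j -> H (sl_elem i j c).
  move=> ij; case: c => k; first exact: HN.
  by rewrite NegzE -sl_elemV//; apply: (HV _ _); exact: HN.
suff [h hg Hh] : exists2 h : SLZ n, val h = val g & H h by rewrite -(val_inj hg).
move: (val g) (eqP (valP g)); apply: (elem_gen (H := fun A => exists2 h : SLZ n, val h = A & H h)).
- by exists 1%g.
- by move=> _ _ [h1 <- H1'] [h2 <- H2']; exists (h1 * h2)%g => //; exact: HM.
- by move=> i j c ij; exists (sl_elem i j c); [exact: val_sl_elem|exact: Hz].
Qed.

Definition letter_sign (x : letter 'I_2) : int := if x.2 then 1 else -1.
(* With 3 instead of the usual 2, the vector (1, 1) lies in no ping-pong region. *)
Definition letter_sl (x : letter 'I_2) : SLZ 2 :=
  if x.1 == 0 then sl_elem 0 1 (3 * letter_sign x) else sl_elem 1 0 (3 * letter_sign x).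

Lemma letter_slV x : letter_sl (linv x) = ((letter_sl x)^-1)%g.
Proof.
rewrite /letter_sl /letter_sign /=.
by case: (x.1 == 0); rewrite sl_elemV//; case: (x.2).
Qed.

(** For the first generator this is the double cone where [v 1 0] is nonzero and smaller than
    [v 0 0] in absolute value and their product has the sign of the letter; for the second one the
    coordinates are exchanged. *)
Definition region (x : letter 'I_2) (v : 'cV[int]_2) : Prop :=
  if x.1 == 0 then v 1 0 * v 1 0 < letter_sign x * (v 0 0 * v 1 0)
  else v 0 0 * v 0 0 < letter_sign x * (v 0 0 * v 1 0).

Lemma I2P (i : 'I_2) : i = 0 \/ i = 1.
Proof. by case: i => -[|[|//]] lt2; [left|right]; exact: val_inj. Qed.

Lemma region_step x y v : region y v -> y != linv x -> region x (val (letter_sl x) *m v).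
Proof.
case: x y => [i e] [j f]; rewrite /region /letter_sl /linv /=.
have s1 := sqr_ge0 (v 0 0 - v 1 0); have s2 := sqr_ge0 (v 0 0 + v 1 0).
rewrite !expr2 in s1 s2.
have [->|->] := I2P i; have [->|->] := I2P j => /=; rewrite val_sl_elem// !elem_mulE /=;
  case: e; case: f; rewrite /letter_sign //= => h _;
  move: (v 0 0) (v 1 0) s1 s2 h => p q; nia.
Qed.

Lemma region_start x : region x (val (letter_sl x) *m const_mx 1).
Proof.
case: x => i e; rewrite /region /letter_sl; have [->|->] := I2P i => /=;
  by rewrite val_sl_elem// !elem_mulE !mxE /letter_sign; case: e.
Qed.

Definition pingpong (u : F2) : SLZ 2 := eval_word letter_sl (fg_word u).

Lemma pingpong_word x w : reduced (x :: w) ->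
  region x (val (eval_word letter_sl (x :: w)) *m const_mx 1).
Proof.
rewrite /eval_word; elim: w x => [|y w IH] x; first by rewrite big_seq1 => _; exact: region_start.
rewrite big_cons /= -mulmxA => /andP[yx yw].
exact: region_step (IH y yw) yx.
Qed.

(** A nonempty reduced word sends (1, 1) into a region, while [c%:M] sends it to itself or its
    opposite, both outside all regions. This gives injectivity and, at the same time, keeps -1 out
    of the image. *)
Lemma pingpong_scalar u c : c * c = 1 -> val (pingpong u) = c%:M -> u = 1%g.
Proof.
move=> cc; case: u => -[|x w] rw uc; first exact: val_inj.
have := pingpong_word rw; rewrite [val _]uc mul_scalar_mx /region !mxE mulr1 cc.
by rewrite /letter_sign; case: ifP; case: (x.2).
Qed.

End PingPong.

(** * The example of 4 by 4 matrices: block diagonal pairs and the central involution -1 *)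

Section SL4.
Variable K : realType.

Fact det_block (A B : SLZ 2) : \det (block_mx (val A) 0 0 (val B) : 'M_(2 + 2)) == 1.
Proof. by rewrite det_ublock (eqP (valP A)) (eqP (valP B)) mulr1. Qed.

Definition sl_block (A B : SLZ 2) : SL4Z := MakeSLZ (det_block A B).

Fact det_opp1 : \det ((-1)%:M : 'M[int]_4) == 1.
Proof. by rewrite det_scalar. Qed.

Definition sl_opp1 : SL4Z := MakeSLZ det_opp1.

Definition sl_iota (p : F2 * F2) : SL4Z := sl_block (pingpong p.1) (pingpong p.2).

Lemma sl_iota_scalar p c : c * c = 1 -> val (sl_iota p) = c%:M -> p = 1%g.
Proof.
move=> cc /= e; have e' : block_mx (val (pingpong p.1)) 0 0 (val (pingpong p.2)) =
    block_mx (c%:M : 'M[int]_2) 0 0 (c%:M : 'M[int]_2).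
  by rewrite -scalar_mx_block; exact: e.
have [e1 _ _ e2] := eq_block_mx e'.
by rewrite [p]surjective_pairing (pingpong_scalar cc e1) (pingpong_scalar cc e2).
Qed.

Lemma SL4Z_not_LG_rigid : exists S : gen_set SL4Z, ~ LG_rigid K (cayley S).
Proof.
apply: (@embedding_not_LG_rigid SL4Z sl_opp1 _ _ sl_iota _ _ _
  [seq sl_elem i j 1 | i <- enum 'I_4, j <- enum 'I_4]).
- by apply: val_inj; rewrite /= -scalar_mxM mulrNN mulr1.
- by move=> g; apply: val_inj; rewrite /= scalar_mxC.
- move=> p q; apply: val_inj; have := mulmx_block (val (pingpong p.1)) 0 0
    (val (pingpong p.2)) (val (pingpong q.1)) 0 0 (val (pingpong q.2)).
  rewrite !mul0mx !mulmx0 !addr0 !add0r => e; rewrite [RHS]e.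
  by rewrite /= /pingpong (eval_mul letter_slV p.1) (eval_mul letter_slV p.2).
- by move=> p /(congr1 val) /= /sl_iota_scalar; apply.
- move=> p; apply/eqP => /[dup] /(congr1 val) /= /sl_iota_scalar -> // /(congr1 val) /=.
  rewrite /pingpong /eval_word big_nil /= -(scalar_mx_block 2 2) => /matrixP/(_ 0 0).
  by rewrite !mxE.
- move=> H H1 HM HV HE; apply: SLZ_ind => // i j.
  by apply: HE; apply/allpairsP; exists (i, j); rewrite !mem_enum.
Qed.

End SL4.

Theorem theorem2 (K : realType) :
  (exists S : gen_set F2xF2xZ2, ~ LG_rigid K (cayley S)) /\
  (exists S : gen_set SL4Z, ~ LG_rigid K (cayley S)).
Proof. by split; [exact: F2xF2xZ2_not_LG_rigid | exact: SL4Z_not_LG_rigid]. Qed.
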